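(* Let $C$ be a random vector in $\mathbb{R}_+^n$ satisfying the asymptotic homogeneity assumption (stated in the context) with exponent $\alpha$ and function $h$. Let $X_1,X_2,\dots$ be i.i.d. copies of $C$ and, for $\lambda>0$ and $K\ge1$, let $$\Phi_{\lambda,K}(p)=-\frac1\lambda\log\Big(\frac1K\sum_{k=1}^Ke^{-\lambda\langle p,X_k\rangle}\Big),\qquad p\in\overline{\Delta}_n.$$ Let $\Psi$ be a random element of $\mathcal{C}$ whose distribution is the weak limit $\mu$, as $K\to\infty$, of the distributions of $K^{\frac1{n+\alpha}}\min_{1\le k\le K}\langle\cdot,X_k\rangle$. Let $(\lambda_K)_{K\ge1}\subset(0,\infty)$ satisfy $\frac{\lambda_K}{K^{1/(n+\alpha)}}\to\infty$ as $K\to\infty$. Then $$K^{\frac1{n+\alpha}}\Phi_{\lambda_K,K}-\frac{K^{1/(n+\alpha)}\log K}{\lambda_K}$$ converges weakly to $\Psi$ as $K\to\infty$. In particular: (i) if $\frac{\lambda_K}{K^{1/(n+\alpha)}\log K}\to\infty$ as $K\to\infty$, then $K^{\frac1{n+\alpha}}\Phi_{\lambda_K,K}$ converges weakly to $\Psi$; and (ii) if $c>0$ is a fixed constant and $\frac{\lambda_K}{K^{1/(n+\alpha)}\log K}\to c$ as $K\to\infty$, then $K^{\frac1{n+\alpha}}\Phi_{\lambda_K,K}$ converges weakly to $\Psi+\frac1c$, a deterministic shift of $\Psi$.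
   Context: Let $n\ge2$, $\mathbb{R}_+^n:=(0,\infty)^n$, $\Delta_n:=\{p\in(0,1)^n:p_1+\cdots+p_n=1\}$, $\overline{\Delta}_n$ its closure, $\langle p,x\rangle=\sum_ip_ix_i$. $\mathcal{C}:=\{\psi:\overline{\Delta}_n\to[0,\infty)\text{ continuous and concave}\}$, with the (metrizable) topology of uniform convergence on compact subsets of $\Delta_n$ and its Borel $\sigma$-algebra. Since the random functions may be negative, weak convergence in the claim is on the space $\widetilde{\mathcal{C}}$ of real-valued continuous concave functions on $\overline{\Delta}_n$, again with the topology of uniform convergence on compact subsets of $\Delta_n$. Asymptotic homogeneity assumption: $C=(C_1,\dots,C_n)$ has a joint density $\rho$ on $\mathbb{R}_+^n$, and there exist $\alpha\in\mathbb{R}$ and a non-negative measurable function $h$ on $\mathbb{R}_+^n$ with $\int_{\mathbb{R}_+^n}h(x)\,dx\in(0,\infty]$ such that $\lim_{\kappa\to0^+}\kappa^{-\alpha}\rho(\kappa x)=h(x)$ for $x\in\mathbb{R}_+^n$, uniformly for $x\in\Delta_n$. Under this assumption $\alpha>-n$ and the weak limit $\mu$ exists. *)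

(* Defs.v *)
From HB Require Import structures.
From mathcomp Require Import all_boot all_order all_algebra.
From mathcomp Require Import all_classical all_reals all_analysis.

Set Implicit Arguments.
Unset Strict Implicit.
Unset Printing Implicit Defensive.

Import Order.TTheory GRing.Theory Num.Theory.
Import numFieldNormedType.Exports.

Local Open Scope classical_set_scope.
Local Open Scope ring_scope.

(* R^n is 'rV[R]_n, with the sigma-algebra generated by the coordinates, i.e.
   its Borel sigma-algebra (as in the library's structure on n.-tuple). *)
Definition measure_rV_display : measure_display.
Proof. exact: default_measure_display. Qed.

Section measurable_rV.
Context {R : realType} {n : nat}.

Let coord : 'I_n -> 'rV[R]_n -> R := fun i x => x ord0 i.

Let rV_set0 : g_sigma_preimage coord set0.
Proof. exact: sigma_algebra0. Qed.

Let rV_setC A : g_sigma_preimage coord A -> g_sigma_preimage coord (~` A).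
Proof. exact: sigma_algebraC. Qed.

Let rV_bigcup (F : (set 'rV[R]_n)^nat) :
  (forall i, g_sigma_preimage coord (F i)) ->
  g_sigma_preimage coord (\bigcup_i (F i)).
Proof. exact: sigma_algebra_bigcup. Qed.

HB.instance Definition _ := @isMeasurable.Build measure_rV_display
  'rV[R]_n (g_sigma_preimage coord) rV_set0 rV_setC rV_bigcup.

Lemma measurable_coord (i : 'I_n) :
  measurable_fun [set: 'rV[R]_n] (fun x => x ord0 i).
Proof.
move=> _ Y mY; rewrite setTI; apply: sub_sigma_algebra => /=.
rewrite -bigcup_seq/=; exists i => /=; first by rewrite mem_index_enum.
by exists Y => //; rewrite setTI.
Qed.

Lemma measurable_fun_rV d (T : measurableType d) (f : T -> 'rV[R]_n) :
  (forall i, measurable_fun [set: T] (fun x => f x ord0 i)) ->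
  measurable_fun [set: T] f.
Proof.
move=> mf; suff: g_sigma_preimage (fun i => coord i \o f) `<=` measurable.
  rewrite g_sigma_preimage_comp => mS _ A mA; apply: mS.
  by exists A.
apply: smallest_sub; first exact: sigma_algebra_measurable.
move=> A; rewrite -bigcup_seq/= => -[i _ [B mB <-]].
exact: mf.
Qed.

End measurable_rV.

Section lebesgue_measure_rV.
Context {R : realType}.

Definition rV_cons n (p : R * 'rV[R]_n) : 'rV[R]_n.+1 :=
  row_mx (p.1)%:M p.2.

Definition rV_uncons n (x : 'rV[R]_n.+1) : R * 'rV[R]_n :=
  (x ord0 ord0, rsubmx (x : 'rV_(1 + n))).

Lemma rV_consK n : cancel (@rV_cons n) (@rV_uncons n).
Proof.
move=> [a x]; rewrite /rV_uncons /rV_cons/=; congr pair; last exact: row_mxKr.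
have -> : ord0 = lshift n ord0 :> 'I_(1 + n) by apply/val_inj.
by rewrite (@row_mxEl _ 1 1 n) mxE eqxx.
Qed.

Lemma measurable_rV_cons n : measurable_fun setT (@rV_cons n).
Proof.
apply: measurable_fun_rV => i.
case: (splitP (i : 'I_(1 + n))) => j ij.
  have -> : i = lshift n j :> 'I_(1 + n) by apply/val_inj.
  apply: (eq_measurable_fun fst) => // -[a x] _ /=.
  by rewrite (@row_mxEl _ 1 1 n) mxE !ord1 eqxx.
have -> : i = rshift 1 j :> 'I_(1 + n) by apply/val_inj.
apply: (eq_measurable_fun ((fun x : 'rV[R]_n => x ord0 j) \o snd)).
  by move=> [a x] _ /=; rewrite (@row_mxEr _ 1 1 n).
apply: measurableT_comp; first exact: measurable_coord.
exact: measurable_snd.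
Qed.

Lemma measurable_rV_uncons n : measurable_fun setT (@rV_uncons n).
Proof.
apply/measurable_fun_pairP; split; first exact: measurable_coord.
apply: measurable_fun_rV => i.
apply: (eq_measurable_fun (fun x : 'rV[R]_n.+1 => x ord0 (rshift 1 i))).
  by move=> x _ /=; rewrite mxE.
exact: measurable_coord.
Qed.

Section step.
Context n (mu : {sigma_finite_measure set 'rV[R]_n -> \bar R}).

Definition lebesgue_rV_step : set 'rV[R]_n.+1 -> \bar R :=
  pushforward (lebesgue_measure \x mu)%E (@rV_cons n).

Let step0 : lebesgue_rV_step set0 = 0%E.
Proof. by rewrite /lebesgue_rV_step /pushforward preimage_set0 measure0. Qed.

Let step_ge0 A : (0 <= lebesgue_rV_step A)%E.
Proof. by rewrite /lebesgue_rV_step /pushforward; exact: measure_ge0. Qed.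

Let step_sigma_additive : semi_sigma_additive lebesgue_rV_step.
Proof.
move=> F mF tF mUF; rewrite /lebesgue_rV_step /pushforward preimage_bigcup.
have mcons B : measurable B -> measurable (@rV_cons n @^-1` B).
  by move=> mB; rewrite -[X in measurable X]setTI; exact: measurable_rV_cons.
apply: measure_semi_sigma_additive => [k||]; first exact: mcons.
- apply/trivIsetP => /= i j _ _ ij; rewrite -preimage_setI.
  by move/trivIsetP : tF => /(_ _ _ _ _ ij) ->//; rewrite preimage_set0.
- by rewrite -preimage_bigcup; exact: mcons.
Qed.

HB.instance Definition _ :=
  isMeasure.Build _ _ _ lebesgue_rV_step step0 step_ge0 step_sigma_additive.

Let sigma_finite_step : sigma_finite setT lebesgue_rV_step.
Proof.
have /sigma_finiteP[F [TF ndF Foo]] :=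
  sigma_finiteT (@lebesgue_measure R : {sigma_finite_measure set _ -> \bar R}).
have /sigma_finiteP[G [TG ndG Goo]] := sigma_finiteT mu.
exists (fun k => @rV_uncons n @^-1` (F k `*` G k)).
  rewrite -preimage_bigcup (_ : \bigcup_k _ = setT)//.
  apply/seteqP; split => // -[x y] _.
  have [k _ Fkx] : (\bigcup_i F i) x by rewrite -TF.
  have [l _ Gly] : (\bigcup_i G i) y by rewrite -TG.
  exists (maxn k l) => //; split => /=.
  - by move: Fkx; exact/subsetPset/ndF/leq_maxl.
  - by move: Gly; exact/subsetPset/ndG/leq_maxr.
move=> k; have [mFk Fkoo] := Foo k; have [mGk Gkoo] := Goo k; split.
  rewrite -[X in measurable X]setTI; apply: measurable_rV_uncons => //.
  exact: measurableX.
rewrite /lebesgue_rV_step /pushforward (_ : _ @^-1` _ = F k `*` G k).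
  by rewrite product_measure1E// lte_mul_pinfty// ge0_fin_numE.
by rewrite -comp_preimage (_ : _ \o _ = id)//; apply/funext/rV_consK.
Qed.

HB.instance Definition _ := Measure_isSigmaFinite.Build _ _ _
  lebesgue_rV_step sigma_finite_step.

End step.

(* Lebesgue measure on R^n; see lebesgue_rV_box. *)
Fixpoint lebesgue_rV n : {sigma_finite_measure set 'rV[R]_n -> \bar R} :=
  match n with
  | 0 => dirac (0 : 'rV[R]_0)
  | n'.+1 => lebesgue_rV_step (lebesgue_rV n')
  end.

Lemma lebesgue_rV_box n (B : 'I_n -> set R) :
  (forall i, measurable (B i)) ->
  (lebesgue_rV n [set x : 'rV[R]_n | forall i, B i (x ord0 i)] =
   \prod_(i < n) lebesgue_measure (B i))%E.
Proof.
elim: n B => [|n IH] B mB.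
  by rewrite big_ord0 /= diracE mem_set//= => -[].
rewrite big_ord_recl -IH; last by move=> i; exact: mB.
have mC : measurable [set x : 'rV[R]_n | forall i, B (lift ord0 i) (x ord0 i)].
  rewrite (_ : mkset _ = \bigcap_(i in setT) ((fun x : 'rV[R]_n => x ord0 i) @^-1` (B (lift ord0 i)))).
    apply: fin_bigcap_measurable => // i _; rewrite -[X in measurable X]setTI; exact: measurable_coord.
  by apply/seteqP; split => x /= H i; [move=> _|]; apply: H.
rewrite -product_measure1E //.
rewrite /= /lebesgue_rV_step /pushforward; congr (_ _).
apply/seteqP; split => -[a x] /=.
  move=> H; split=> [|i].
    by have := H ord0; rewrite /rV_cons mxE; case: splitP => // j _; rewrite mxE !ord1 eqxx.
  have := H (lift ord0 i); rewrite /rV_cons mxE. case: splitP => // j /=; first by case: j => -[].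
  by rewrite /bump /= !add1n => -[] e; have -> : j = i by apply/val_inj.
move=> [Ha Hx] i; rewrite /rV_cons mxE; case: splitP => j ij.
  by rewrite mxE !ord1 eqxx; rewrite (_ : i = ord0)//; apply/val_inj; rewrite /= ij ord1.
by rewrite (_ : i = lift ord0 j)//; apply/val_inj; rewrite /= ij.
exact: mB.
Qed.

End lebesgue_measure_rV.

Definition orthant (R : realType) n : set 'rV[R]_n :=
  [set x | forall i, 0 < x ord0 i].

Definition simplex (R : realType) n : set 'rV[R]_n :=
  [set p | (forall i, 0 < p ord0 i < 1) /\ \sum_i p ord0 i = 1].

Definition csimplex (R : realType) n : set 'rV[R]_n := closure (@simplex R n).

Arguments orthant : clear implicits.
Arguments simplex : clear implicits.
Arguments csimplex : clear implicits.

Definition dotv (R : realType) n (p x : 'rV[R]_n) : R :=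
  \sum_i p ord0 i * x ord0 i.

Section simplex_functions.
Variables (R : realType) (n : nat).

(* The set_type csimplex carries the subspace topology of 'rV[R]_n; functions
   on it carry the topology of uniform convergence on the compact subsets of
   the open simplex. *)
Definition simplex_fun :=
  {family compactly_in [set p : csimplex R n | simplex R n (\val p)],
     csimplex R n -> R}.

HB.instance Definition _ := Pointed.copy simplex_fun (csimplex R n -> R).
HB.instance Definition _ := Uniform.copy simplex_fun
  {family compactly_in [set p : csimplex R n | simplex R n (\val p)],
     csimplex R n -> R}.

Definition concave_on_simplex (f : csimplex R n -> R) :=
  forall (t : R) (p q r : csimplex R n), 0 <= t <= 1 ->
    \val r = t *: \val p + (1 - t) *: \val q ->
    t * f p + (1 - t) * f q <= f r.

Definition Ctilde : set simplex_fun :=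
  [set f | continuous (f : csimplex R n -> R) /\ concave_on_simplex f].

Definition Cplus : set simplex_fun :=
  [set f | Ctilde f /\ forall p, 0 <= f p].

End simplex_functions.

Section weak_convergence.
Variables (R : realType) (E : ptopologicalType).

(* S is endowed with the subspace topology of E and with the Borel
   sigma-algebra of that topology. *)
Definition random_element d (T : measurableType d) (S : set E) (Z : T -> E) :=
  (forall w, S (Z w)) /\
  measurable_fun [set: T] (Z : T -> g_sigma_algebraType (@open E)).

Definition cvg_in_law d (T : measurableType d) (P : probability T R)
    d' (T' : measurableType d') (Q : probability T' R)
    (S : set E) (Z : nat -> T -> E) (W : T' -> E) :=
  [/\ forall K, random_element S (Z K),
      random_element S W &
      forall F : E -> R, {within S, continuous F} ->
        (exists M : R, forall f, S f -> `|F f| <= M) ->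
        ('E_P[F \o Z K] @[K --> \oo] --> 'E_Q[F \o W])%E].

End weak_convergence.

Section random_vectors.
Variables (R : realType) (n : nat).

Definition has_density d (T : measurableType d) (P : probability T R)
    (C : {RV P >-> 'rV[R]_n}) (rho : 'rV[R]_n -> R) :=
  [/\ forall x, orthant R n x -> 0 <= rho x,
      measurable_fun (orthant R n) rho &
      forall A : set 'rV[R]_n, measurable A ->
        distribution P C A =
        (\int[lebesgue_rV n]_(x in A `&` orthant R n) (rho x)%:E)%E].

Definition asymp_homogeneous d (T : measurableType d) (P : probability T R)
    (C : {RV P >-> 'rV[R]_n}) (alpha : R) (h : 'rV[R]_n -> R) :=
  exists rho : 'rV[R]_n -> R,
  let resc (kappa : R) (x : 'rV[R]_n) :=
    kappa `^ (- alpha) * rho (kappa *: x) in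
  [/\ has_density C rho,
      forall x, orthant R n x -> 0 <= h x,
      measurable_fun (orthant R n) h,
      (0 < \int[lebesgue_rV n]_(x in orthant R n) (h x)%:E)%E &
      (forall x, orthant R n x -> resc kappa x @[kappa --> 0^'+] --> h x) /\
      {uniform simplex R n, resc kappa @[kappa --> 0^'+] --> h}].

Definition mutually_independent d (T : measurableType d) (P : probability T R)
    (X : nat -> {RV P >-> 'rV[R]_n}) :=
  forall (s : seq nat) (A : nat -> set 'rV[R]_n), uniq s ->
    (forall k, measurable (A k)) ->
    P (\bigcap_(k in [set` s]) (X k @^-1` A k)) =
    (\prod_(k <- s) P (X k @^-1` A k))%E.

Definition iid_copies d (T : measurableType d) (P : probability T R)
    d' (T' : measurableType d') (Q : probability T' R)
    (X : nat -> {RV P >-> 'rV[R]_n}) (C : {RV Q >-> 'rV[R]_n}) :=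
  mutually_independent X /\
  forall k (A : set 'rV[R]_n), measurable A ->
    distribution P (X k) A = distribution Q C A.

End random_vectors.

(* The sample X_1, ..., X_K is x 0, ..., x (K - 1). *)
Definition softmin_lin (R : realType) n (lambda : R) (K : nat)
    (x : nat -> 'rV[R]_n) (p : 'rV[R]_n) : R :=
  - lambda^-1 *
    ln (K%:R^-1 * \sum_(k < K) expR (- (lambda * dotv p (x k)))).

(* x 0 is itself a term of the minimum as soon as 0 < K; it only gives a
   value for K = 0. *)
Definition min_lin (R : realType) n (K : nat)
    (x : nat -> 'rV[R]_n) (p : 'rV[R]_n) : R :=
  \big[Order.min/dotv p (x 0%N)]_(k < K) dotv p (x k).

(* Main.v *)
Require Import Defs.
From HB Require Import structures.
From mathcomp Require Import all_boot all_order all_algebra.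
From mathcomp Require Import all_classical all_reals all_analysis.
From mathcomp Require Import measurable_realfun ring lra.

Import Order.TTheory GRing.Theory Num.Theory.
Import numFieldNormedType.Exports.

Set Implicit Arguments.
Unset Strict Implicit.

Local Open Scope classical_set_scope.
Local Open Scope ring_scope.

(** Put [gamma = n + alpha], [a = K^(1/gamma)], and rescale the sample to
    [y_k = a X_k].  With [beta = lambda_K / a -> oo], the normalized soft minimum
    is [- beta^-1 ln S(p)], where [S(p)] is the sum of the
    [exp (- beta <p, y_k>)], and it never exceeds the minimum [m(p)] of the
    [<p, y_k>].  For [beta >= 1], factoring out [exp (- (beta - 1) m(p))] gives
    [S(p) <= exp (- beta m(p)) exp (m(p)) W] with [W] the sum of the
    [exp (- <p, y_k>)].  Hence the soft minimum and the minimum differ by at most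
    [(m(p) + ln W) / beta], and [ln W <= W] ([softmin_min_dist]), so it suffices
    that [m] and [W] are bounded in probability, uniformly for [p] in a compact
    part of the open simplex.

    On the set of [p] with all coordinates at least [delta], [m(p)] is at most [n]
    times its value at the barycenter, which is tight because the minima converge
    in law ([eval_tight]), and [W] is at most the sum of the
    [exp (- delta |y_k|)], [|.|] being the sum of the coordinates.  The mean of
    the latter is bounded in [K]: the homogeneity of the density near the origin
    yields [P (|C| <= s) <= c s^gamma] ([lower_tail_le]), therefore
    [E exp (- t |C|) <= D t^(- gamma)] ([laplace_le]), and [a] is the scale at
    which [K] such terms add up to a constant ([laplace_sum_mean]).  That [gamma]
    is positive is Fatou's lemma ([exponent_gt0]).

    It remains to pass from closeness in probability to convergence in law
    ([cvg_in_law_close]).  A bounded function continuous on the concave functions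
    is the pointwise limit from below of functions that are Lipschitz for uniform
    distance on compact sets; for these the two means get close, and the bounds
    from below for [F] and [- F] give the limit.  The three claims then only
    differ by a deterministic shift converging to [0], [0] or [1/c]
    ([softmin_cvg_in_law]). *)

(** * The topology of the function space *)

Section topology.
Context {R : realType} {n : nat}.

(** For positive [delta] these sets are compact; as [delta] decreases to 0 they
    exhaust the open simplex. *)
Definition core (delta : R) : set (csimplex R n) :=
  [set p : csimplex R n | forall i, delta <= \val p ord0 i].

(** A bound on the uniform distance over a core, kept as a relation so that it
    makes sense for functions that are unbounded there. *)
Definition uclose (delta : R) (f g : simplex_fun R n) (s : R) :=
  forall p, core delta p -> `|f p - g p| <= s.

Lemma closed_coord_ge (b : R) i :
  closed [set x : 'rV[R]_n | b <= x ord0 i].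
Proof.
apply: (@closed_comp _ _ (fun x : 'rV[R]_n => x ord0 i) [set y | b <= y]).
  by move=> x _; apply: coord_continuous.
exact: closed_ge.
Qed.

Lemma sum_coord_continuous :
  continuous (fun x : 'rV[R]_n => \sum_i x ord0 i).
Proof.
apply: continuous_big => [|i _]; last exact: coord_continuous.
exact: add_continuous.
Qed.

Lemma closed_sum_coord : closed [set x : 'rV[R]_n | \sum_i x ord0 i = 1].
Proof.
apply: (@closed_comp _ _ (fun x : 'rV[R]_n => \sum_i x ord0 i) [set 1]).
  by move=> x _; exact: sum_coord_continuous.
exact: closed_eq.
Qed.

Lemma csimplex_ge0 (p : csimplex R n) i : 0 <= \val p ord0 i.
Proof.
have : csimplex R n (\val p) by exact: set_valP.
move: (\val p) => x xc; apply: (@closed_coord_ge 0 i).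
by apply: closureS xc => y [/(_ i)/andP[/ltW]].
Qed.

Lemma csimplex_sum (p : csimplex R n) : \sum_i \val p ord0 i = 1.
Proof.
have : csimplex R n (\val p) by exact: set_valP.
move: (\val p) => x xc; apply: closed_sum_coord.
by apply: closureS xc => y [].
Qed.

Lemma csimplex_le1 (p : csimplex R n) i : \val p ord0 i <= 1.
Proof.
rewrite -(csimplex_sum p) (bigD1 i)//= lerDl sumr_ge0// => j _.
exact: csimplex_ge0.
Qed.

Lemma csimplex_coord_continuous i :
  continuous (fun p : csimplex R n => \val p ord0 i).
Proof.
move=> p; apply: (@continuous_comp _ _ _ (\val : csimplex R n -> _)
  (fun x : 'rV[R]_n => x ord0 i)).
  exact: initial_continuous.
exact: coord_continuous.
Qed.

Hypothesis n2 : (2 <= n)%N.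

(** With at least two positive coordinates of sum 1, none can reach 1. *)
Lemma simplex_gt0 (x : 'rV[R]_n) :
  (forall i, 0 < x ord0 i) -> \sum_i x ord0 i = 1 -> simplex R n x.
Proof.
move=> x0 x1; split => // i; rewrite x0/= -x1.
have [j ji] : exists j : 'I_n, j != i.
  case: n n2 i => [|[|k]]// _ i.
  by have [->|i0] := eqVneq i ord0; [exists ord_max|exists ord0; rewrite eq_sym].
rewrite (bigD1 i)//= (bigD1 j)//= ltrDl ltr_pwDl// ?x0//.
by apply: sumr_ge0 => k _; exact: ltW.
Qed.

Lemma core_simplex (delta : R) (p : csimplex R n) :
  0 < delta -> core delta p -> simplex R n (\val p).
Proof.
move=> d0 dp; apply: simplex_gt0; last exact: csimplex_sum.
by move=> i; exact: lt_le_trans (dp i).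
Qed.

(** The image in the space of vectors is closed and bounded; a cluster point
    there lies in the open simplex, hence is a point of the closed simplex, where
    it is a cluster point for the subspace topology. *)
Lemma compact_core (delta : R) : 0 < delta -> compact (core delta).
Proof.
move=> d0 F FF FA.
pose K := [set x : 'rV[R]_n | (forall i, delta <= x ord0 i) /\
                              \sum_i x ord0 i = 1].
have cK : compact K.
  apply: bounded_closed_compact.
    exists 1; split => // M M1 x [xd x1] /=.
    rewrite (le_trans _ (ltW M1))// [leLHS]mx_normrE.
    apply: bigmax_le => // -[i j] _ /=; rewrite ord1.
    have x0 k : 0 <= x ord0 k by rewrite (le_trans (ltW d0)).
    by rewrite ger0_norm// -x1 (bigD1 j)//= lerDl sumr_ge0.
  rewrite (_ : K = \bigcap_i [set x : 'rV[R]_n | delta <= x ord0 i] `&`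
                   [set x : 'rV[R]_n | \sum_i x ord0 i = 1]).
    apply: closedI; last exact: closed_sum_coord.
    by apply: closed_bigI => i _; exact: closed_coord_ge.
  apply/seteqP; split => x [a b]; split => //= i; first by move=> _; exact: a.
  exact: (a i).
have /cK : ((\val : csimplex R n -> 'rV[R]_n) @ F) K.
  suff : F ((\val : csimplex R n -> 'rV[R]_n) @^-1` K) by [].
  by apply: filterS FA => p dp; split => //; exact: csimplex_sum.
move=> [x [[xd x1] xF]].
have sx : simplex R n x.
  by apply: simplex_gt0 => // i; exact: lt_le_trans (xd i).
have cx : x \in csimplex R n by rewrite inE; exact: subset_closure.
exists (SigSub cx); split => // A B FA' [_ [[W oW <-] /= Wx] WB].
have /xF/(_ _) : ((\val : csimplex R n -> 'rV[R]_n) @ F) (\val @` A).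
  suff : F ((\val : csimplex R n -> 'rV[R]_n) @^-1` (\val @` A)) by [].
  by apply: filterS FA' => p Ap; exists p.
move=> /(_ _ (open_nbhs_nbhs (conj oW Wx)))[_ [[p Ap <-] Wp]].
by exists p; split => //; exact: WB.
Qed.

(** Each coordinate attains a positive minimum on a compact set. *)
Lemma compact_sub_core (A : set (csimplex R n)) : compact A ->
  (forall p, A p -> simplex R n (\val p)) ->
  exists2 delta, 0 < delta & A `<=` core delta.
Proof.
move=> cA As.
have /choice[b bP] : forall i : 'I_n, exists b : R, 0 < b /\
    forall p : csimplex R n, A p -> b <= \val p ord0 i.
  move=> i; have [->|/set0P A0] := eqVneq A set0; first by exists 1.
  have [|p pA pmin] := compact_EVT_min A0 cA (f := fun p : csimplex R n => \val p ord0 i).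
    by apply: continuous_subspaceT; exact: csimplex_coord_continuous.
  exists (\val p ord0 i); split; last by move=> q Aq; apply: pmin; rewrite inE.
  by move: pA; rewrite inE => /As[/(_ i)/andP[]].
exists (\big[Order.min/1]_i b i).
  by apply: lt_bigmin => // i _; have [] := bP i.
move=> p Ap i; apply: (@le_trans _ _ (b i)); first exact: bigmin_le.
by have [_] := bP i; exact.
Qed.

(** With [uclose_nbhs]: the balls for uniform distance over the cores form a
    basis of neighbourhoods, so that all topological arguments below can be
    carried out with [uclose] alone. *)
Lemma nbhs_uclose (f : simplex_fun R n) (delta s : R) : 0 < delta -> 0 < s ->
  nbhs f [set g | uclose delta f g s].
Proof.
move=> d0 s0; have := @fam_nbhs (csimplex R n) R _ (core delta)
  [set xy : R * R | `|xy.1 - xy.2| < s] f.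
move=> H; have {H} : nbhs (f : simplex_fun R n)
    [set g | forall y, core delta y -> `|f y - g y| < s].
  apply: H; first exact: entourage_ball (PosNum s0).
  by split; [move=> p; exact: core_simplex|exact: compact_core].
by apply: filterS => g H p /H/ltW.
Qed.

Lemma uclose_nbhs (f : simplex_fun R n) (U : set (simplex_fun R n)) :
  nbhs f U ->
  exists delta s, [/\ 0 < delta, 0 < s &
    forall g, uclose delta f g s -> U g].
Proof.
move=> fU.
pose F : set_system (csimplex R n -> R) := filter_from
  [set ds : R * R | 0 < ds.1 /\ 0 < ds.2]
  (fun ds => [set g | uclose ds.1 f g ds.2]).
have FF : Filter F.
  apply: filter_from_filter; first by exists (1, 1).
  move=> [d1 s1] [d2 s2] /= [d10 s10] [d20 s20].
  exists (Num.min d1 d2, Num.min s1 s2).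
    by rewrite /= !lt_min d10 d20 s10.
  move=> g /= H; split => p /= dp.
    apply: le_trans (H p _) _; last by rewrite ge_min lexx.
    by move=> i; rewrite (le_trans _ (dp i))// ge_min lexx.
  apply: le_trans (H p _) _; last by rewrite ge_min lexx orbT.
  by move=> i; rewrite (le_trans _ (dp i))// ge_min lexx orbT.
have Ff : {family compactly_in
    [set p : csimplex R n | simplex R n (\val p)], F --> f}.
  apply/fam_cvgP => A [As cA] B /uniform_nbhs[E [entE EB]].
  have [delta d0 Ad] := compact_sub_core cA As.
  move: entE; rewrite -entourage_ballE => -[e /= e0 eE].
  exists (delta, e / 2) => /=; first by rewrite divr_gt0.
  move=> g /= fg; apply: EB => p Ap; apply: eE => /=.
  rewrite /ball/=; apply: le_lt_trans (fg p (Ad _ Ap)) _.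
  by rewrite ltr_pdivrMr// mulr_natr mulr2n ltrDl.
by have [[d s] /= [d0 s0] dsU] := Ff _ fU; exists d, s.
Qed.

Lemma uclose_sym (delta s : R) f g : uclose delta f g s -> uclose delta g f s.
Proof. by move=> H p /H; rewrite distrC. Qed.

Lemma uclose_trans (delta s t : R) f g k :
  uclose delta f g s -> uclose delta g k t -> uclose delta f k (s + t).
Proof.
move=> H1 H2 p dp; rewrite (le_trans (ler_distD (g p) _ _))//.
by rewrite lerD// ?H1 ?H2.
Qed.

End topology.

(** * Means of bounded variables and convergence in law *)

Section bounded_mean.
Context {R : realType} d (T : measurableType d) (P : probability T R).
Implicit Types X Y : T -> R.

Lemma bounded_integrable X (M : R) : measurable_fun setT X ->
  (forall w, `|X w| <= M) -> P.-integrable setT (EFin \o X).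
Proof.
move=> mX XM; apply: measurable_bounded_integrable => //.
  by rewrite [ltLHS]probability_setT ltry.
by exists M; split; [exact: num_real|move=> x Mx w _]; exact: le_trans (XM w) (ltW Mx).
Qed.

Lemma expectation_Rintegral X (M : R) : measurable_fun setT X ->
  (forall w, `|X w| <= M) -> 'E_P[X]%E = (\int[P]_w X w)%:E.
Proof.
move=> mX XM; rewrite unlock /Rintegral fineK//.
exact: integrable_fin_num (bounded_integrable mX XM).
Qed.

(** On the exceptional set the difference of the two variables is at most the
    oscillation [2 M]. *)
Lemma le_Rintegral_off (M c : R) X Y (B : set T) : measurable B ->
  measurable_fun setT X -> measurable_fun setT Y ->
  (forall w, `|X w| <= M) -> (forall w, `|Y w| <= M) ->
  0 <= c -> (forall w, ~ B w -> X w <= Y w + c) ->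
  \int[P]_w X w <= \int[P]_w Y w + (c + 2 * M * fine (P B)).
Proof.
move=> mB mX mY XM YM c0 XY.
have M0 : 0 <= M.
  case: (pselect (exists w : T, True)) => [[w _]|Tn].
    exact: le_trans (XM w).
  have : P setT = 0%E.
    by rewrite (_ : setT = set0) ?measure0//; apply/seteqP; split => // w _; case: Tn;
      exists w.
  by rewrite probability_setT => /eqP; rewrite eqe oner_eq0.
have mI : measurable_fun setT (\1_B : T -> R) by exact: measurable_indic.
have mZ : measurable_fun setT (fun w => c + 2 * M * \1_B w).
  by apply: measurable_funD => //; exact: measurable_funM.
have iX := bounded_integrable mX XM; have iY := bounded_integrable mY YM.
have ZM w : `|c + 2 * M * \1_B w| <= c + 2 * M.
  rewrite indicE; case: (w \in B); rewrite ?mulr1 ?mulr0 ?addr0 ger0_norm//.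
  - by rewrite addr_ge0// mulr_ge0.
  - by rewrite lerDl mulr_ge0.
have iZ := bounded_integrable mZ ZM.
rewrite (_ : c + _ = \int[P]_w (c + 2 * M * \1_B w)).
  rewrite -RintegralD//; apply: le_Rintegral => //.
    exact: integrableD iY iZ.
  move=> w _; rewrite indicE; have [Bw|nBw] := pselect (B w); last first.
    by rewrite memNset// mulr0 addr0; exact: XY.
  rewrite mem_set// mulr1 (le_trans (ler_norm _))// (le_trans (XM w))//.
  have : - M <= Y w by rewrite lerNl (le_trans _ (YM w))// -normrN ler_norm.
  by move: c0; lra.
have iI : P.-integrable setT (EFin \o (\1_B : T -> R)).
  apply: (@bounded_integrable _ 1) => // w.
  by rewrite indicE; case: (w \in B); rewrite ?normr1 ?normr0.
have iC : P.-integrable setT (EFin \o (fun=> c)).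
  by apply: (@bounded_integrable _ c) => // w; rewrite ger0_norm.
rewrite RintegralD//.
  rewrite Rintegral_cst// [X in _ = c * fine X + _]probability_setT mulr1.
  rewrite RintegralZl//; congr (_ + _ * _).
  by rewrite /Rintegral integral_indic// setIT.
apply: (@bounded_integrable _ (2 * M)); first exact: measurable_funM.
move=> w; rewrite indicE; case: (w \in B); rewrite ?mulr1 ?mulr0 ?normr0 ?mulr_ge0//.
by rewrite ger0_norm ?mulr_ge0.
Qed.

End bounded_mean.

Section laws.
Context {R : realType} {E : ptopologicalType}.

(** A set open relatively to [S] is the trace of an open set, and the two have
    the same preimage because [Z] does not leave [S]. *)
Lemma random_element_measurable d (T : measurableType d) (S : set E)
    (Z : T -> E) (F : E -> R) : random_element S Z ->
  {within S, continuous F} -> measurable_fun setT (F \o Z).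
Proof.
move=> [SZ mZ] /continuousP cF.
apply: (measurability _ (RGenOpens.measurableE R)).
move=> _ [_ [a [b ->] <-]].
have /open_subspaceP[U oU US] :
    open ((F @^-1` `]a, b[%classic) : set (subspace S)).
  exact/cF/interval_open.
have mU : measurable (U : set (g_sigma_algebraType (@open E))).
  exact: sub_sigma_algebra.
have := mZ measurableT U mU.
rewrite !setTI (_ : Z @^-1` U = (F \o Z) @^-1` `]a, b[%classic)//.
apply/seteqP; split => w /= h.
  by have [] : ((F @^-1` `]a, b[%classic) `&` S) (Z w) by rewrite -US.
by have [] : (U `&` S) (Z w) by rewrite US.
Qed.

Lemma random_element_map {E' : ptopologicalType} d (T : measurableType d) (S : set E)
    (S' : set E') (tau : E -> E') (Z : T -> E) : continuous tau ->
  (forall x, S x -> S' (tau x)) ->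
  random_element S Z -> random_element S' (tau \o Z).
Proof.
move=> ctau St [SZ mZ]; split; first by move=> w; exact: St.
apply: (@measurability _ _ T (g_sigma_algebraType (@open E')) setT _
  (@open E')) => // _ [U oU <-].
rewrite setTI comp_preimage -[X in measurable X]setTI; apply: mZ => //.
apply: sub_sigma_algebra; apply: open_comp oU => x _; exact: ctau.
Qed.

End laws.

(** The continuous mapping theorem: a test function on [S'] composed with [tau]
    is a test function on [S]. *)
Lemma cvg_in_law_map {R : realType} {E E' : ptopologicalType}
    d (T : measurableType d) (P : probability T R)
    d' (T' : measurableType d') (Q : probability T' R)
    (S : set E) (S' : set E') (tau : E -> E') (Z : nat -> T -> E) (W : T' -> E) :
  continuous tau -> (forall x, S x -> S' (tau x)) ->
  cvg_in_law P Q S Z W ->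
  cvg_in_law P Q S' (fun K => tau \o Z K) (tau \o W).
Proof.
move=> ctau St [SZ SW ZW]; split.
- by move=> K; exact: random_element_map (SZ K).
- exact: random_element_map SW.
move=> F cF [M FM]; apply: (ZW (F \o tau)).
  apply/subspace_continuousP => x Sx.
  move/subspace_continuousP : cF => /(_ _ (St _ Sx)); apply: cvg_comp => V.
  rewrite /within /= => SV.
  have SVt : nbhs x (fun y => S' (tau y) -> V (tau y)) by exact: ctau SV.
  have : nbhs x (fun y => S y -> V (tau y)).
    by apply: filterS SVt => y h /St; exact: h.
  by [].
by exists M => f Sf; exact/FM/St.
Qed.

(** * Convergence in law of asymptotically close random functions *)

Lemma nbhs_infty_lt_natS {R : realType} (r : R) :
  \forall k \near \oo, r < k.+1%:R.
Proof.
near=> k; apply: lt_trans (_ : k%:R < _); last by rewrite ltr_nat.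
by near: k; exact: nbhs_infty_gtr.
Unshelve. all: end_near. Qed.

Section slutsky.
Context {R : realType} {n : nat}.
Hypothesis n2 : (2 <= n)%N.
Local Notation E := (simplex_fun R n).
Variables (S : set E) (F : E -> R) (M : R).
Hypothesis cF : {within S, continuous F}.
Hypothesis FM : forall f, S f -> `|F f| <= M.

(** The topology is generated by uniform distances over the cores, so the
    penalty lets the core grow and its slope increase with the same index.  The
    value [M] keeps the set inhabited and its infimum at most [M], even for
    functions far from [S]. *)
Definition penalty_values (j : nat) (f : E) : set R :=
  [set r | r = M \/ exists g s,
    [/\ S g, 0 <= s, uclose j.+1%:R^-1 f g s & r = F g + j.+1%:R * s]].

Definition lipschitz_minorant (j : nat) (f : E) : R := inf (penalty_values j f).

Hypothesis M0 : 0 <= M.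

Lemma penalty_values_ge j f r : penalty_values j f r -> - M <= r.
Proof.
move=> [->|[g [s [Sg s0 _ ->]]]]; first by rewrite (le_trans _ M0)// oppr_le0.
have : - M <= F g by rewrite lerNl (le_trans _ (FM Sg))// -normrN ler_norm.
by move=> H; rewrite (le_trans H)// lerDl mulr_ge0.
Qed.

Lemma lipschitz_minorant_le j f r :
  penalty_values j f r -> lipschitz_minorant j f <= r.
Proof.
by apply: ge_inf; exists (- M) => s; exact: penalty_values_ge.
Qed.

Lemma lipschitz_minorant_ge j f b :
  (forall r, penalty_values j f r -> b <= r) -> b <= lipschitz_minorant j f.
Proof. by apply: lb_le_inf; exists M; left. Qed.

Lemma lipschitz_minorant_bounded j f : `|lipschitz_minorant j f| <= M.
Proof.
rewrite ler_norml; apply/andP; split; last by apply: lipschitz_minorant_le; left.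
by apply: lipschitz_minorant_ge => r; exact: penalty_values_ge.
Qed.

Lemma lipschitz_minorant_lip j f f' s : 0 <= s ->
  uclose j.+1%:R^-1 f f' s ->
  lipschitz_minorant j f <= lipschitz_minorant j f' + j.+1%:R * s.
Proof.
move=> s0 ff'; rewrite -lerBlDr; apply: lipschitz_minorant_ge => r.
rewrite lerBlDr => -[->|[g [t [Sg t0 f'g ->]]]].
  by rewrite (@le_trans _ _ M) ?lerDl ?mulr_ge0//; apply: lipschitz_minorant_le; left.
apply: lipschitz_minorant_le; right; exists g, (s + t); split => //.
- exact: addr_ge0.
- exact: uclose_trans f'g.
- by rewrite mulrDr; ring.
Qed.

Lemma lipschitz_minorant_continuous j : continuous (lipschitz_minorant j).
Proof.
move=> f; apply/(@cvgrPdist_le _ _ E (nbhs f) _) => e e0.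
have d0 : (0 : R) < j.+1%:R^-1 by rewrite invr_gt0.
have s0 : 0 < e / j.+1%:R by rewrite divr_gt0.
have js : j.+1%:R * (e / j.+1%:R) = e by rewrite mulrC divfK.
have := nbhs_uclose n2 f d0 s0; apply: filterS => g /= fg.
rewrite ler_distl; apply/andP; split.
  by rewrite lerBlDr -[X in _ + X]js lipschitz_minorant_lip ?(ltW s0)//;
    exact: uclose_sym.
by rewrite -[X in _ + X]js lipschitz_minorant_lip ?(ltW s0).
Qed.

Lemma lipschitz_minorant_self j f : S f -> lipschitz_minorant j f <= F f.
Proof.
move=> Sf; apply: lipschitz_minorant_le; right; exists f, 0; split => //.
  by move=> p _; rewrite subrr normr0.
by rewrite mulr0 addr0.
Qed.

(** Competitors uniformly close to [f] on a large core have nearly the value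
    [F f] by continuity; the others pay a penalty of at least [2 M]. *)
Lemma lipschitz_minorant_cvg f : S f ->
  lipschitz_minorant j f @[j --> \oo] --> F f.
Proof.
move=> Sf; apply/cvgrPdist_le => e e0.
have : \forall g \near within S (nbhs f), `|F f - F g| <= e.
  by move/subspace_continuousP : cF => /(_ _ Sf)/cvgrPdist_le; exact.
move=> /uclose_nbhs[delta [s [d0 s0 fgS]]].
near=> j; rewrite ger0_norm ?subr_ge0 ?lipschitz_minorant_self//.
rewrite lerBlDr -lerBlDl; apply: lipschitz_minorant_ge => r.
have FfM : F f <= M by rewrite (le_trans (ler_norm _))// FM.
move=> [->|[g [t [Sg t0 fg ->]]]].
  by rewrite (le_trans _ FfM)// gerBl ltW.
have [ts|st] := leP t s.
  rewrite (@le_trans _ _ (F g)) ?lerDl ?mulr_ge0//.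
  rewrite lerBlDr -lerBlDl (le_trans (ler_norm _))//.
  apply: fgS => // p dp; rewrite (le_trans _ ts)//; apply: fg => i.
  rewrite (le_trans _ (dp i))// invf_ple ?posrE// ltW//.
  by near: j; exact: nbhs_infty_lt_natS.
have FgM : - M <= F g by rewrite lerNl (le_trans _ (FM Sg))// -normrN ler_norm.
have jM : 2 * M <= j.+1%:R * t.
  rewrite (@le_trans _ _ (j.+1%:R * s)) ?ler_wpM2l ?(ltW st)//.
  by rewrite -ler_pdivrMr//; apply: ltW; near: j; exact: nbhs_infty_lt_natS.
by move: FfM FgM jM (e0); lra.
Unshelve. all: end_near. Qed.

End slutsky.

Section converging_together.
Context {R : realType} {n : nat}.
Hypothesis n2 : (2 <= n)%N.
Local Notation E := (simplex_fun R n).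
Context d (T : measurableType d) (P : probability T R).
Context d' (T' : measurableType d') (Q : probability T' R).
Variables (S : set E) (Z Z' : nat -> T -> E) (W : T' -> E).

(** The set where closeness fails is an uncountable union over [p], hence the
    measurable set [B] that contains it. *)
Definition close_in_probability := forall delta s e : R,
  0 < delta -> 0 < s -> 0 < e ->
  \forall K \near \oo, exists B, [/\ measurable B, (P B <= e%:E)%E &
    forall w, ~ B w -> uclose delta (Z K w) (Z' K w) s].

Hypothesis ZW : cvg_in_law P Q S Z W.
Hypothesis SZ' : forall K, random_element S (Z' K).
Hypothesis ZZ' : close_in_probability.

(** A Lipschitz minorant of [F] loses little in mean under the limit law by
    dominated convergence; along the sequence its mean converges, and it is
    insensitive to replacing [Z] by the close [Z']. *)
Lemma mean_liminf (F : E -> R) (M : R) : {within S, continuous F} ->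
  (forall f, S f -> `|F f| <= M) ->
  forall e, 0 < e -> \forall K \near \oo,
    \int[Q]_w F (W w) - e <= \int[P]_w F (Z' K w).
Proof.
have [SZ SW cvgZ] := ZW; move=> cF FM e e0.
have M0 : 0 <= M.
  have w0 : T' by exact: point.
  by apply: le_trans (FM (W w0) _) => //; have [] := SW.
pose G := lipschitz_minorant S F M.
have cG j : continuous (G j) := lipschitz_minorant_continuous n2 FM M0 (j := j).
have cGS j : {within S, continuous (G j)}.
  by apply: continuous_subspaceT; exact: cG.
have GM j f : `|G j f| <= M := lipschitz_minorant_bounded FM M0 j f.
have e4 : 0 < e / 4 by rewrite divr_gt0.
have mFW := random_element_measurable SW cF.
have mGW j := random_element_measurable SW (cGS j).
have mGZ j K := random_element_measurable (SZ K) (cGS j).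
have mGZ' j K := random_element_measurable (SZ' K) (cGS j).
have mFZ' K := random_element_measurable (SZ' K) cF.
have FWM w : `|(F \o W) w| <= M by apply: FM; have [] := SW.
have FZ'M K w : `|(F \o Z' K) w| <= M by apply: FM; have [] := SZ' K.
have GFW : \int[Q]_w G j (W w) @[j --> \oo] --> \int[Q]_w F (W w).
  have := @dominated_convergence _ T' R Q setT measurableT
    (fun j w => (G j (W w))%:E) (fun w => (F (W w))%:E) (fun=> M%:E).
  case.
  - by move=> j; apply/measurable_EFinP; exact: mGW.
  - exact/measurable_EFinP.
  - apply: aeW => w _; apply: cvg_EFin; first exact: nearW.
    by apply: lipschitz_minorant_cvg => //; have [] := SW.
  - by apply: (@bounded_integrable _ _ _ Q (fun=> M) M) => // w; rewrite ger0_norm.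
  - by apply: aeW => w j _; rewrite lee_fin; exact: GM.
  have := expectation_Rintegral Q mFW FWM; rewrite unlock /= => ->.
  by move=> _ _ /fine_cvg.
have [j Gj] : exists j, \int[Q]_w F (W w) - e / 4 <= \int[Q]_w G j (W w).
  near \oo => j; exists j; near: j.
  by move/cvgrPdist_le : GFW => /(_ _ e4); apply: filterS => j;
    rewrite ler_distl -!lerBlDr => /andP[].
have GZW : \int[P]_w G j (Z K w) @[K --> \oo] --> \int[Q]_w G j (W w).
  have H : ('E_P[G j \o Z K] @[K --> \oo] --> (\int[Q]_w G j (W w))%:E)%E.
    rewrite -(@expectation_Rintegral _ _ _ Q (G j \o W) M)//; last first.
      by move=> w; exact: GM.
    by apply: cvgZ => //; exists M => f _; exact: GM.
  have {}H : fine 'E_P[G j \o Z K]%E @[K --> \oo] --> \int[Q]_w G j (W w).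
    exact: fine_cvg H.
  apply: cvg_trans H; apply: near_eq_cvg; near=> K => /=.
  by rewrite (@expectation_Rintegral _ _ _ _ _ M)// => w; exact: GM.
have d0 : (0 : R) < j.+1%:R^-1 by rewrite invr_gt0.
have s0 : 0 < e / 4 / j.+1%:R by rewrite divr_gt0.
(* with this probability the exceptional set contributes at most e / 4 *)
have eM : 0 < e / 4 / (2 * M + 1) by rewrite divr_gt0// ltr_wpDl// mulr_ge0.
have close := ZZ' d0 s0 eM.
move/cvgrPdist_le : GZW => /(_ _ e4) GZW.
near=> K.
have [B [mB PB BZ]] : exists B, [/\ measurable B, (P B <= (e / 4 / (2 * M + 1))%:E)%E &
    forall w, ~ B w -> uclose j.+1%:R^-1 (Z K w) (Z' K w) (e / 4 / j.+1%:R)].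
  by near: K.
have h1 : \int[Q]_w G j (W w) - e / 4 <= \int[P]_w G j (Z K w).
  by near: K; apply: filterS GZW => K; rewrite ler_distl -!lerBlDr => /andP[].
have h2 : \int[P]_w G j (Z K w) <=
    \int[P]_w G j (Z' K w) + (e / 4 + 2 * M * fine (P B)).
  apply: (@le_Rintegral_off _ _ _ P M (e / 4) (G j \o Z K) (G j \o Z' K)) => //.
  - by move=> w; exact: GM.
  - by move=> w; exact: GM.
  - exact: ltW.
  move=> w /BZ H; rewrite [X in _ + X](_ : _ = j.+1%:R * (e / 4 / j.+1%:R)).
    by apply: lipschitz_minorant_lip => //; exact: ltW.
  by rewrite [RHS]mulrC divfK.
have h3 : 2 * M * fine (P B) <= e / 4.
  have PBe : fine (P B) <= e / 4 / (2 * M + 1).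
    by rewrite -lee_fin fineK// fin_num_measure.
  rewrite (@le_trans _ _ (2 * M * (e / 4 / (2 * M + 1))))//.
    by rewrite ler_wpM2l// mulr_ge0.
  have M1 : 0 < 2 * M + 1 by rewrite ltr_wpDl// mulr_ge0.
  by rewrite mulrA ler_pdivrMr// mulrDr mulr1 [leLHS]mulrC lerDl ltW.
have h4 : \int[P]_w G j (Z' K w) <= \int[P]_w F (Z' K w).
  apply: le_Rintegral => //.
  - by apply: (@bounded_integrable _ _ _ P (G j \o Z' K) M) => // w; exact: GM.
  - exact: (@bounded_integrable _ _ _ P (F \o Z' K) M).
  - move=> w _; apply: lipschitz_minorant_self => //.
    by have [] := SZ' K.
move: Gj h1 h2 h3 h4; lra.
Unshelve. all: end_near. Qed.

(** Slutsky's theorem: [mean_liminf] applies to [F] and to [- F]. *)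
Lemma cvg_in_law_close : cvg_in_law P Q S Z' W.
Proof.
have [SZ SW _] := ZW; split => // F cF [M FM].
have mFW := random_element_measurable SW cF.
have mFZ' K := random_element_measurable (SZ' K) cF.
have FWM w : `|(F \o W) w| <= M by apply: FM; have [] := SW.
have FZ'M K w : `|(F \o Z' K) w| <= M by apply: FM; have [] := SZ' K.
rewrite (@expectation_Rintegral _ _ _ _ _ M)//.
apply: cvg_EFin.
  by near=> K; rewrite (@expectation_Rintegral _ _ _ _ _ M).
apply/cvgrPdist_le => e e0.
have cNF : {within S, continuous (\- F)} by move=> x; apply: continuousN; exact: cF.
have NFM f : S f -> `|(\- F) f| <= M by move=> /FM; rewrite normrN.
have IN d1 (T1 : measurableType d1) (P1 : probability T1 R) (X : T1 -> R) :
    measurable_fun setT X -> (forall w, `|X w| <= M) ->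
    \int[P1]_w (- X w) = - \int[P1]_w X w.
  move=> mX XM; rewrite -mulN1r -RintegralZl//.
    by apply: eq_Rintegral => w _; rewrite mulN1r.
  exact: bounded_integrable XM.
have := mean_liminf cNF NFM e0.
have := mean_liminf cF FM e0.
apply: filterS2 => K /= h1.
rewrite (IN _ _ _ (F \o W))// (IN _ _ _ (F \o Z' K))// => h2.
rewrite /= (@expectation_Rintegral _ _ _ _ _ M)//=; last exact: FZ'M.
rewrite ler_distl.
by move: h1 h2 => /=; lra.
Unshelve. all: end_near. Qed.

End converging_together.

(** * Soft minimum against minimum *)

Section softmin.
Context {R : realType} {n : nat}.
Implicit Types (x : nat -> 'rV[R]_n) (p q : 'rV[R]_n) (lambda : R).

Definition norm1 (y : 'rV[R]_n) : R := \sum_i y ord0 i.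

Definition partition_sum lambda K x p : R :=
  \sum_(k < K) expR (- (lambda * dotv p (x k))).

Lemma partition_sum_gt0 lambda K x p : (0 < K)%N ->
  0 < partition_sum lambda K x p.
Proof.
case: K => // K _; rewrite /partition_sum big_ord_recl ltr_pwDl ?expR_gt0//.
by apply: sumr_ge0 => i _; exact: expR_ge0.
Qed.

Lemma softmin_lin0 lambda x p : softmin_lin lambda 0 x p = 0.
Proof. by rewrite /softmin_lin big_ord0 mulr0 ln0// mulr0. Qed.

Lemma softmin_linE lambda K x p : (0 < K)%N ->
  softmin_lin lambda K x p =
  lambda^-1 * ln K%:R - lambda^-1 * ln (partition_sum lambda K x p).
Proof.
move=> K0; rewrite /softmin_lin lnM ?posrE ?invr_gt0 ?ltr0n//.
  by rewrite lnV ?posrE ?ltr0n// -/(partition_sum _ _ _ _); ring.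
exact: partition_sum_gt0.
Qed.

Lemma softmin_lin_le lambda K x x' p s : 0 < lambda ->
  (forall k, (k < K)%N -> dotv p (x k) <= dotv p (x' k) + s) ->
  (0 < K)%N ->
  softmin_lin lambda K x p <= softmin_lin lambda K x' p + s.
Proof.
move=> l0 xx' K0; rewrite !softmin_linE//.
set A := partition_sum _ _ x _; set A' := partition_sum _ _ x' _.
have A0 : 0 < A by exact: partition_sum_gt0.
have A'0 : 0 < A' by exact: partition_sum_gt0.
suff : ln A' <= lambda * s + ln A.
  rewrite -(ler_pM2l (x := lambda^-1)) ?invr_gt0// mulrDr mulKf ?gt_eqF//; lra.
rewrite -[lambda * s]expRK -lnM ?posrE ?expR_gt0//.
rewrite ler_ln ?posrE ?mulr_gt0 ?expR_gt0// mulr_sumr ler_sum// => k _.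
rewrite -expRD ler_expR; have := xx' _ (ltn_ord k).
rewrite -(ler_pM2l l0) mulrDr; lra.
Qed.

(** Soft minima, like minima, are 1-Lipschitz for the supremum distance. *)
Lemma softmin_lin_dist lambda K x x' p s : ((0 < K)%N -> 0 < lambda) -> 0 <= s ->
  (forall k, (k < K)%N -> `|dotv p (x k) - dotv p (x' k)| <= s) ->
  `|softmin_lin lambda K x p - softmin_lin lambda K x' p| <= s.
Proof.
move=> l0 s0 xx'; have [K0|] := posnP K.
  by rewrite K0 !softmin_lin0 subrr normr0.
move=> K0; rewrite ler_distl lerBlDr.
by apply/andP; split; apply: softmin_lin_le => //; try exact: l0;
  move=> k /xx'; rewrite ler_distl lerBlDr => /andP[].
Qed.

Lemma dotvDl (t u : R) p q (y : 'rV[R]_n) :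
  dotv (t *: p + u *: q) y = t * dotv p y + u * dotv q y.
Proof.
rewrite /dotv !mulr_sumr -big_split/=; apply: eq_bigr => i _.
by rewrite !mxE; ring.
Qed.

Lemma expR_convex (t u v : R) : 0 <= t <= 1 ->
  expR (t * u + (1 - t) * v) <= t * expR u + (1 - t) * expR v.
Proof.
move=> /andP[t0 t1]; pose t' := Itv01 t0 t1.
have := @convex_expR R t' u v.
by rewrite !convRE.
Qed.

(** The logarithm of a sum of exponentials is convex: after normalizing by
    the sums [A] and [B] at the two end points, convexity of the exponential can
    be applied term by term. *)
Lemma softmin_lin_concave lambda K x p q (t : R) : ((0 < K)%N -> 0 < lambda) ->
  0 <= t <= 1 ->
  t * softmin_lin lambda K x p + (1 - t) * softmin_lin lambda K x q <=
  softmin_lin lambda K x (t *: p + (1 - t) *: q).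
Proof.
move=> l0 t01; have [K0|K0] := posnP K.
  by rewrite K0 !softmin_lin0 !mulr0 addr0.
rewrite !softmin_linE//.
set A := partition_sum _ _ _ p; set B := partition_sum _ _ _ q.
set D := partition_sum _ _ _ _.
have A0 : 0 < A by exact: partition_sum_gt0.
have B0 : 0 < B by exact: partition_sum_gt0.
have D0 : 0 < D by exact: partition_sum_gt0.
suff : ln D <= t * ln A + (1 - t) * ln B.
  rewrite -(ler_pM2l (x := lambda^-1)) ?invr_gt0 ?l0// mulrDr; lra.
rewrite -[leRHS]expRK ler_ln ?posrE ?expR_gt0// -subr_le0.
rewrite -(pmulr_rle0 _ (expR_gt0 (- (t * ln A + (1 - t) * ln B)))).
rewrite mulrBr -expRD addNr expR0 subr_le0 /D /partition_sum mulr_sumr.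
have le1 : \sum_(k < K) (t * (expR (- (lambda * dotv p (x k))) / A) +
    (1 - t) * (expR (- (lambda * dotv q (x k))) / B)) <= 1.
  rewrite big_split/= -!mulr_sumr -!mulr_suml.
  by rewrite !divff ?gt_eqF//; lra.
apply: le_trans le1; apply: ler_sum => k _.
have eA u : expR u / A = expR (u - ln A) by rewrite expRB lnK.
have eB u : expR u / B = expR (u - ln B) by rewrite expRB lnK.
rewrite eA eB -expRD dotvDl.
apply: le_trans (expR_convex _ _ t01).
by rewrite ler_expR; lra.
Qed.

Lemma dotv_continuous (y : 'rV[R]_n) : continuous (fun p : 'rV[R]_n => dotv p y).
Proof.
apply: continuous_big => [|i _]; first exact: add_continuous.
have ci : continuous (fun p : 'rV[R]_n => p ord0 i).
  by move=> p; exact: coord_continuous.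
by move=> p; apply: continuousM; [exact: ci|exact: cst_continuous].
Qed.

Lemma softmin_lin_continuous lambda K x :
  continuous (softmin_lin lambda K x : 'rV[R]_n -> R).
Proof.
have [->|K0] := posnP K.
  rewrite (_ : softmin_lin _ _ _ = cst 0); first exact: cst_continuous.
  by apply/funext => p; rewrite softmin_lin0.
have cS : continuous (partition_sum lambda K x).
  apply: continuous_big => [|k _]; first exact: add_continuous.
  move=> p; apply: (@continuous_comp _ _ _
    (fun p => - (lambda * dotv p (x k))) (@expR R)); last exact: continuous_expR.
  apply: (@continuousN _ _ _ (fun p => lambda * dotv p (x k))).
  by apply: continuousM; [exact: cst_continuous|exact: dotv_continuous].
have cl : continuous (fun p => ln (partition_sum lambda K x p)).
  move=> p; apply: (@continuous_comp _ _ _ (partition_sum lambda K x) (@ln R)).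
    exact: cS.
  by apply: continuous_ln; exact: partition_sum_gt0.
rewrite (_ : softmin_lin _ _ _ =
  fun p => lambda^-1 * ln K%:R - lambda^-1 * ln (partition_sum lambda K x p)).
  move=> p; apply: (@continuousB _ _ _ (fun=> lambda^-1 * ln K%:R)
    (fun p => lambda^-1 * ln (partition_sum lambda K x p))).
    exact: cst_continuous.
  by apply: continuousM; [exact: cst_continuous|exact: cl].
by apply/funext => p; rewrite softmin_linE.
Qed.

Lemma min_lin_le K x p k : (k < K)%N -> min_lin K x p <= dotv p (x k).
Proof.
by move=> kK; rewrite /min_lin (bigmin_le _ (Ordinal kK) (fun k : 'I_K => dotv p (x k))).
Qed.

Lemma min_lin_attained K x p : (0 < K)%N ->
  exists2 k, (k < K)%N & min_lin K x p = dotv p (x k).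
Proof.
move=> K0; apply: (big_ind (fun r => exists2 k, (k < K)%N & r = dotv p (x k))).
- by exists 0%N.
- move=> _ _ [k kK ->] [l lK ->].
  by case: leP => _; [exists k|exists l].
- by move=> k _; exists k.
Qed.

Definition barycenter : 'rV[R]_n := const_mx n%:R^-1.

Lemma dotv_barycenter (y : 'rV[R]_n) : dotv barycenter y = n%:R^-1 * norm1 y.
Proof. by rewrite /dotv mulr_sumr; apply: eq_bigr => i _; rewrite mxE. Qed.

Lemma dotv_le_norm1 p (y : 'rV[R]_n) : (forall i, p ord0 i <= 1) ->
  orthant R n y -> dotv p y <= norm1 y.
Proof.
by move=> p1 y0; apply: ler_sum => i _; rewrite ler_piMl// ltW.
Qed.

Lemma dotv_ge_norm1 (delta : R) p (y : 'rV[R]_n) : (forall i, delta <= p ord0 i) ->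
  orthant R n y -> delta * norm1 y <= dotv p y.
Proof.
move=> pd y0; rewrite mulr_sumr; apply: ler_sum => i _.
by rewrite ler_wpM2r// ltW.
Qed.

Lemma min_lin_le_barycenter K x p : (0 < n)%N -> (0 < K)%N ->
  (forall i, p ord0 i <= 1) -> (forall k, orthant R n (x k)) ->
  min_lin K x p <= n%:R * min_lin K x barycenter.
Proof.
move=> n0 K0 p1 x0; have [k kK ->] := min_lin_attained x barycenter K0.
rewrite dotv_barycenter mulVKf ?gt_eqF ?ltr0n//.
by apply: le_trans (min_lin_le x p kK) _; exact: dotv_le_norm1.
Qed.

(** The key estimate: the relative weights of the terms above the minimum are
    compared with those at [lambda = a], where their sum is controlled in mean;
    the excess [lambda - a] only multiplies differences of the right sign. *)
Lemma softmin_min_dist (delta a lambda : R) K x p :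
  (0 < n)%N -> (0 < K)%N -> 0 < a -> a <= lambda ->
  (forall i, 0 <= p ord0 i <= 1) -> (forall i, delta <= p ord0 i) ->
  (forall k, orthant R n (x k)) ->
  `|a * softmin_lin lambda K x p - a * ln K%:R / lambda - a * min_lin K x p| <=
  a / lambda * (n%:R * (a * min_lin K x barycenter) +
                \sum_(k < K) expR (- (delta * a * norm1 (x k)))).
Proof.
move=> n0 K0 a0 al p01 pd x0.
have l0 : 0 < lambda by exact: lt_le_trans al.
have p1 i : p ord0 i <= 1 by have /andP[] := p01 i.
set W := \sum_(k < K) _; set m := min_lin K x p.
have W0 : 0 < W.
  rewrite /W; case: (K) K0 => // k _.
  by rewrite big_ord_recl ltr_pwDl ?expR_gt0// sumr_ge0// => i _; exact: expR_ge0.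
have mb : a * m <= n%:R * (a * min_lin K x barycenter).
  by rewrite mulrCA ler_pM2l//; exact: min_lin_le_barycenter.
rewrite softmin_linE//; set S := partition_sum _ _ _ _.
have S0 : 0 < S by exact: partition_sum_gt0.
have lnW : ln W <= W.
  by rewrite -ler_expR lnK// (le_trans _ (expR_ge1Dx _))// lerDr.
(* the smallest exponent alone bounds the sum from below *)
have Sge : - (lambda * m) <= ln S.
  have [k kK mk] := min_lin_attained x p K0.
  rewrite -ler_expR lnK// /m mk /S /partition_sum (bigD1 (Ordinal kK))//=.
  by rewrite lerDl sumr_ge0// => i _; exact: expR_ge0.
have Sle : ln S <= - (lambda * m) + a * m + ln W.
  rewrite -ler_expR lnK// expRD lnK// mulr_sumr ler_sum// => k _.
  rewrite -expRD ler_expR.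
  have mk : m <= dotv p (x k) by exact: min_lin_le.
  have : a * (delta * norm1 (x k)) <= a * dotv p (x k).
    by rewrite ler_pM2l//; exact: dotv_ge_norm1.
  have : (lambda - a) * m <= (lambda - a) * dotv p (x k).
    by rewrite ler_wpM2l// subr_ge0.
  lra.
have -> : a * (lambda^-1 * ln K%:R - lambda^-1 * ln S) - a * ln K%:R / lambda -
    a * m = - (a / lambda * (ln S + lambda * m)).
  by field; rewrite gt_eqF.
have al0 : 0 <= a / lambda by rewrite divr_ge0 ?ltW.
rewrite normrN ger0_norm; last by rewrite mulr_ge0//; lra.
by rewrite ler_wpM2l//; lra.
Qed.

End softmin.

(** * The soft minimum as a random concave function *)

Section measurable_matrix.
Context {R : realType} d (T : measurableType d) (m n : nat).

(** An open set of matrices is a countable union of open boxes with rational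
    centers. *)
Lemma measurable_preimage_open_mx (M : T -> 'M[R]_(m, n)) (U : set 'M[R]_(m, n)) :
  (forall i j, measurable_fun setT (fun w => M w i j)) ->
  open U -> measurable (M @^-1` U).
Proof.
move=> mM oU.
pose box (q : 'M[rat]_(m, n)) (k : nat) := [set y : 'M[R]_(m, n) |
  forall i j, `|y i j - ratr (q i j)| < k.+1%:R^-1].
have mbox q k : measurable (M @^-1` box q k).
  rewrite (_ : M @^-1` _ = \bigcap_(ij in [set: 'I_m * 'I_n])
      ((fun w => M w ij.1 ij.2 - ratr (q ij.1 ij.2)) @^-1`
        [set r | `|r| < k.+1%:R^-1])); last first.
    apply/seteqP; split => w /=; first by move=> h [i j] _ /=; exact: h.
    by move=> h i j; exact: (h (i, j)).
  apply: fin_bigcap_measurable => // -[i j] _ /=.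
  rewrite -[X in measurable X]setTI.
  apply: (measurable_funB (mM i j) (measurable_cst _)) => //.
  apply: open_measurable.
  rewrite (_ : [set r | _] = (fun r : R => `|r|) @^-1` [set r | r < k.+1%:R^-1])//.
  by apply: open_comp; [move=> r _; exact: norm_continuous|exact: open_lt].
rewrite (_ : U = \bigcup_(qk in [set qk : 'M[rat]_(m, n) * nat | box qk.1 qk.2 `<=` U])
                  box qk.1 qk.2).
  rewrite preimage_bigcup bigcup_mkcond; apply: countable_bigcupT_measurable.
    by [].
  by move=> [q k] /=; case: ifP => // _; exact: measurable0.
apply/seteqP; split => [x Ux|x [[q k]/= + bx]]; last exact.
have /nbhs_ballP[e/= e0 eU] : nbhs x U by exact: open_nbhs_nbhs.
have [k ke] : exists k : nat, k.+1%:R^-1 < e / 2.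
  near \oo => k; exists k; near: k;
    exact: near_infty_natSinv_lt (PosNum (divr_gt0 e0 (ltr0Sn R 1))).
have /choice[q qP] : forall ij : 'I_m * 'I_n, exists q : rat,
    `|x ij.1 ij.2 - ratr q| < k.+1%:R^-1.
  move=> [i j] /=.
  have : (0 : R) < k.+1%:R^-1 by rewrite invr_gt0.
  move: (k.+1%:R^-1) => b b0.
  have xk : x i j - b < x i j + b by rewrite ltrD2l gtrN.
  have [q] := rat_in_itvoo xk; rewrite in_itv/= => /andP[q1 q2].
  by exists q; rewrite ltr_distl; move: q1 q2; lra.
pose Q : 'M[rat]_(m, n) := \matrix_(i, j) q (i, j).
exists (Q, k) => /=; last by move=> i j; rewrite mxE; exact: (qP (i, j)).
move=> y yQ; apply: eU; split => // i j.
rewrite /ball/= (le_lt_trans (ler_distD (ratr (q (i, j))) _ _))//.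
have yq : `|ratr (q (i, j)) - y i j| < e / 2.
  by rewrite distrC; have := lt_trans (yQ i j) ke; rewrite mxE.
by have xq := lt_trans (qP (i, j)) ke; rewrite [ltRHS]splitr ltrD.
Unshelve. all: end_near. Qed.

End measurable_matrix.

Section softmin_random_element.
Context {R : realType} {n : nat}.
Local Notation E := (simplex_fun R n).

Definition softmin_fun (a lambda r : R) K (x : nat -> 'rV[R]_n) : E :=
  fun p => a * softmin_lin lambda K x (\val p) + r.

Lemma softmin_fun_Ctilde (a lambda r : R) K (x : nat -> 'rV[R]_n) :
  0 <= a -> ((0 < K)%N -> 0 < lambda) -> Ctilde (softmin_fun a lambda r K x).
Proof.
move=> a0 l0; split.
  have h : continuous (fun p : csimplex R n => softmin_lin lambda K x (\val p)).
    move=> p; apply: (@continuous_comp _ _ _ (\val : csimplex R n -> _)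
      (softmin_lin lambda K x)); first exact: initial_continuous.
    exact: softmin_lin_continuous.
  move=> p; apply: (@continuousD _ _ _
    (fun p : csimplex R n => a * softmin_lin lambda K x (\val p)) (fun=> r)).
    by apply: continuousM; [exact: cst_continuous|exact: h].
  exact: cst_continuous.
move=> t p q s t01 sE; rewrite /softmin_fun sE.
have := softmin_lin_concave x (\val p) (\val q) l0 t01.
move=> /(ler_wpM2l a0); lra.
Qed.

Lemma dotv_dist (p : csimplex R n) (y z : 'rV[R]_n) (s : R) :
  (forall i, `|y ord0 i - z ord0 i| <= s) ->
  `|dotv (\val p) y - dotv (\val p) z| <= s.
Proof.
move=> yz; rewrite /dotv -sumrB (le_trans (ler_norm_sum _ _ _))//.
rewrite -[leRHS]mul1r -(csimplex_sum p) mulr_suml ler_sum// => i _.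
by rewrite -mulrBr normrM ger0_norm ?csimplex_ge0// ler_wpM2l// csimplex_ge0.
Qed.

(** Only the first [K] vectors enter the soft minimum; the others are set to 0. *)
Definition mx_rows K (x : 'M[R]_(K, n)) (k : nat) : 'rV[R]_n :=
  if insub k is Some i then row i x else 0.

Lemma softmin_fun_mx_continuous (a lambda r : R) K : ((0 < K)%N -> 0 < lambda) ->
  continuous (fun x : 'M[R]_(K, n) => softmin_fun a lambda r K (mx_rows x) : E).
Proof.
move=> l0 x U /= /uclose_nbhs[delta [s [d0 s0 xU]]].
have a1 : 0 < `|a| + 1 by rewrite ltr_wpDl.
apply/nbhs_ballP; exists (s / (`|a| + 1)) => /=; first by rewrite divr_gt0.
move=> y xy; apply: xU => p _; rewrite /softmin_fun.
rewrite opprD addrACA subrr addr0 -mulrBr normrM.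
rewrite (@le_trans _ _ (`|a| * (s / (`|a| + 1))))//.
  rewrite ler_wpM2l// softmin_lin_dist ?divr_ge0 ?(ltW s0) ?(ltW a1)// => k kK.
  apply: dotv_dist => i; rewrite /mx_rows insubT !mxE; apply: ltW.
  by have [_] := xy; exact.
by rewrite mulrA ler_pdivrMr// mulrC ler_wpM2l ?(ltW s0)// lerDl.
Qed.

(** The function space is not separable, and its Borel sets need not be
    generated by point evaluations.  Measurability comes instead from the
    continuity of the soft minimum as a function of the matrix of the sample. *)
Lemma softmin_random_element d (T : measurableType d) (X : nat -> T -> 'rV[R]_n)
    (a lambda r : R) K : 0 <= a -> ((0 < K)%N -> 0 < lambda) ->
  (forall k, measurable_fun setT (X k)) ->
  random_element (@Ctilde R n)
    (fun w => softmin_fun a lambda r K (fun k => X k w)).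
Proof.
move=> a0 l0 mX; split; first by move=> w; exact: softmin_fun_Ctilde.
pose M w : 'M[R]_(K, n) := \matrix_(k, i) X k w ord0 i.
have GM : (fun w => softmin_fun a lambda r K (fun k => X k w)) =
    (fun x : 'M[R]_(K, n) => softmin_fun a lambda r K (mx_rows x)) \o M.
  apply/funext => w /=; apply/funext => p; rewrite /softmin_fun /softmin_lin.
  congr (_ * (_ * ln (_ * _)) + _); apply: eq_bigr => k _.
  suff -> : mx_rows (M w) k = X k w by [].
  by rewrite /mx_rows valK; apply/rowP => i; rewrite !mxE.
rewrite GM; apply: (@measurability _ _ T (g_sigma_algebraType (@open E)) setT _
  (@open E)) => // _ [U oU <-].
rewrite setTI comp_preimage; apply: measurable_preimage_open_mx.
  move=> k i; rewrite (_ : (fun w => M w k i) = (fun y : 'rV[R]_n => y ord0 i) \o X k).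
    apply: measurableT_comp; first exact: measurable_coord.
    exact: mX.
  by apply/funext => w /=; rewrite mxE.
by apply: open_comp oU => x _; exact: softmin_fun_mx_continuous.
Qed.

End softmin_random_element.

(** * Scaling of Lebesgue measure *)

(** An image measure as a bundled measure, which further measure constructions
    take as argument. *)
Lemma pushforward_measureP d1 d2 (T1 : measurableType d1)
    (T2 : measurableType d2) (R : realType) (m : {measure set T1 -> \bar R})
    (f : T1 -> T2) : measurable_fun setT f ->
  exists nu : {measure set T2 -> \bar R}, nu = pushforward m f :> (set T2 -> \bar R).
Proof. move=> mf; by eexists (pushforward m f : {measure set T2 -> \bar R}).
Unshelve. exact: mf. Qed.

Section scaling.
Context {R : realType}.
Local Notation leb := (@lebesgue_measure R).

Lemma measurable_scale1 (k : R) :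
  measurable_fun setT ( *%R k : measurableTypeR R -> measurableTypeR R).
Proof. exact: measurable_funM. Qed.

Lemma ge0_integral_scale1 (k : R) (f : R -> \bar R) : 0 < k ->
  measurable_fun setT f -> (forall x, 0 <= f x)%E ->
  (\int[leb]_x f x = k%:E * \int[leb]_x f (k * x)%R)%E.
Proof.
move=> k0 mf f0; have k0' : 0 <= k by exact: ltW.
have [nu nuE] := pushforward_measureP leb (measurable_scale1 k).
transitivity (\int[mscale (NngNum k0') nu]_x f x)%E.
  apply: eq_measure_integral => A mA _; apply: lebesgue_measure_unique mA.
  move=> _ [[a b]] _ <- /=; rewrite /mscale/= nuE /pushforward.
  rewrite (_ : _ @^-1` _ = `]a / k, b / k]%classic); last first.
    by apply/seteqP; split => x /=; rewrite !in_itv/= ltr_pdivrMr// ler_pdivlMr//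
      ![_ * k]mulrC.
  have itvk := lebesgue_measure_itv `]a / k, b / k].
  rewrite lebesgue_measure_itv/= [X in (_ * X)%E]itvk/= !lte_fin ltr_pM2r ?invr_gt0//.
  case: ifPn => _; last by rewrite mule0.
  by rewrite -!EFinB -EFinM -mulrBl mulrCA divff ?gt_eqF// mulr1.
rewrite ge0_integral_mscale//= nuE ge0_integral_pushforward//.
Qed.

Lemma measurable_scale n (k : R) :
  measurable_fun setT (fun x : 'rV[R]_n => k *: x).
Proof.
apply: measurable_fun_rV => i.
apply: (eq_measurable_fun (fun x : 'rV[R]_n => k * x ord0 i)).
  by move=> x _; rewrite mxE.
by apply: measurable_funM => //; exact: measurable_coord.
Qed.

(** Induction on the dimension, by Tonelli's theorem. *)
Lemma ge0_integral_scale n (k : R) (f : 'rV[R]_n -> \bar R) : 0 < k ->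
  measurable_fun setT f -> (forall x, 0 <= f x)%E ->
  (\int[lebesgue_rV n]_x f x =
   (k ^+ n)%:E * \int[lebesgue_rV n]_x f (k *: x)%R)%E.
Proof.
move=> k0; elim: n f => [|n IH] f mf f0.
  rewrite expr0 mul1e; apply: eq_integral => x _; congr f.
  by apply/rowP => -[].
have stepE (g : 'rV[R]_n.+1 -> \bar R) : measurable_fun setT g ->
    (forall x, 0 <= g x)%E -> (\int[lebesgue_rV n.+1]_x g x =
    \int[leb]_t \int[lebesgue_rV n]_x g (rV_cons (t, x)))%E.
  move=> mg g0.
  have mcons : measurable_fun setT (g \o @rV_cons R n).
    by apply: measurableT_comp => //; exact: measurable_rV_cons.
  have cons0 z : (0 <= (g \o @rV_cons R n) z)%E by exact: g0.
  rewrite -[RHS](fubini_tonelli1 (m1 := leb) (m2 := lebesgue_rV n) (g \o @rV_cons R n))//.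
  transitivity (\int[pushforward (leb \x lebesgue_rV n)%E (@rV_cons R n)]_x g x)%E.
    by [].
  rewrite ge0_integral_pushforward//; first exact: measurable_rV_cons.
have mfk : measurable_fun setT (fun x : 'rV[R]_n.+1 => f (k *: x)).
  by apply: measurableT_comp => //; exact: measurable_scale.
have consE (t : R) (x : 'rV[R]_n) : k *: rV_cons (t, x) = rV_cons (k * t, k *: x).
  apply/rowP => i; rewrite /rV_cons !mxE; case: splitP => j _; rewrite !mxE//.
  by rewrite mulrnAr.
have mcons : measurable_fun setT (f \o @rV_cons R n).
  by apply: measurableT_comp => //; exact: measurable_rV_cons.
have mkcons : measurable_fun setT ((fun x : 'rV[R]_n.+1 => f (k *: x)) \o @rV_cons R n).
  by apply: measurableT_comp => //; exact: measurable_rV_cons.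
have cons0 z : (0 <= (f \o @rV_cons R n) z)%E by exact: f0.
have kcons0 z : (0 <= ((fun x : 'rV[R]_n.+1 => f (k *: x)) \o @rV_cons R n) z)%E.
  exact: f0.
have mF := measurable_fun_fubini_tonelli_F (m2 := lebesgue_rV n) _ mcons cons0.
have mFk := measurable_fun_fubini_tonelli_F (m2 := lebesgue_rV n) _ mkcons kcons0.
rewrite stepE// stepE// (ge0_integral_scale1 k0 mF); last first.
  by move=> t; apply: integral_ge0 => x _; exact: f0.
rewrite exprS EFinM -muleA; congr (_ * _)%E.
rewrite -ge0_integralZl_EFin//; last 2 first.
- by move=> t _; apply: integral_ge0 => x _; exact: f0.
- by rewrite exprn_ge0// ltW.
apply: eq_integral => t _; rewrite /fubini_F /= (IH (fun x => f (rV_cons (k * t, x))))//.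
  by congr (_ * _)%E; apply: eq_integral => x _; rewrite consE.
by apply: (measurableT_comp mcons); exact: pair1_measurable.
Qed.

End scaling.

(** * The law of the sample near the origin *)

Section lower_tail.
Context {R : realType} {n : nat}.
Hypothesis n2 : (2 <= n)%N.
Context d0 (T0 : measurableType d0) (P0 : probability T0 R).
Variable C : {RV P0 >-> 'rV[R]_n}.
Hypothesis C_pos : forall w, orthant R n (C w).
Local Notation leb := (lebesgue_rV n).

Lemma measurable_norm1 : measurable_fun setT (@norm1 R n).
Proof.
rewrite (_ : @norm1 R n = fun x => \sum_i x ord0 i)//.
by apply: measurable_sum => i; exact: measurable_coord.
Qed.

Definition norm1_ball (s : R) : set 'rV[R]_n := [set x | norm1 x <= s].

Lemma measurable_norm1_ball (s : R) : measurable (norm1_ball s).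
Proof.
rewrite (_ : norm1_ball s = setT `&` (@norm1 R n @^-1` `]-oo, s]%classic)).
  exact: measurable_norm1.
by rewrite setTI; apply/seteqP; split => x /=; rewrite in_itv.
Qed.

Lemma measurable_orthant : measurable (orthant R n).
Proof.
rewrite (_ : orthant R n = \bigcap_(i in [set: 'I_n])
    ((fun x : 'rV[R]_n => x ord0 i) @^-1` `]0, +oo[%classic)).
  apply: fin_bigcap_measurable => // i _.
  by rewrite -[X in measurable X]setTI; exact: measurable_coord.
apply/seteqP; split => x xO i; first by move=> _ /=; rewrite in_itv/= andbT; exact: xO.
by have /= := xO i I; rewrite in_itv/= andbT.
Qed.

Lemma norm1_ge0 (x : 'rV[R]_n) : orthant R n x -> 0 <= norm1 x.
Proof. by move=> x0; apply: sumr_ge0 => i _; exact: ltW. Qed.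

Lemma norm1_gt0 (x : 'rV[R]_n) : orthant R n x -> 0 < norm1 x.
Proof.
move=> x0; rewrite /norm1 (bigD1 (Ordinal (ltnW n2)))//= ltr_pwDl ?x0//.
by apply: sumr_ge0 => i _; exact: ltW.
Qed.

Lemma norm1Z (k : R) (x : 'rV[R]_n) : norm1 (k *: x) = k * norm1 x.
Proof. by rewrite /norm1 mulr_sumr; apply: eq_bigr => i _; rewrite mxE. Qed.

Lemma orthantZ (k : R) (x : 'rV[R]_n) : 0 < k ->
  orthant R n (k *: x) <-> orthant R n x.
Proof.
move=> k0; split=> xO i; have := xO i; rewrite mxE; first by rewrite pmulr_rgt0.
by move=> ?; rewrite mulr_gt0.
Qed.

Lemma simplex_normalize (x : 'rV[R]_n) : orthant R n x ->
  simplex R n ((norm1 x)^-1 *: x).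
Proof.
move=> xO; have x0 := norm1_gt0 xO.
apply: simplex_gt0 => //; first by move=> i; rewrite mxE mulr_gt0 ?invr_gt0.
by rewrite -[LHS]/(norm1 _) norm1Z mulVf ?gt_eqF.
Qed.

Lemma lebesgue_bounded (s : R) : 0 <= s ->
  (leb (norm1_ball s `&` orthant R n) < +oo)%E.
Proof.
move=> s0.
apply: (@le_lt_trans _ _ (leb [set x : 'rV[R]_n | forall i : 'I_n, `[0, s]%classic (x ord0 i)])).
  apply: le_measure; rewrite ?inE.
  - by apply: measurableI; [exact: measurable_norm1_ball|exact: measurable_orthant].
  - rewrite (_ : [set x | _] = \bigcap_(i in [set: 'I_n])
      ((fun x : 'rV[R]_n => x ord0 i) @^-1` `[0, s]%classic)).
      apply: fin_bigcap_measurable => // i _.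
      by rewrite -[X in measurable X]setTI; exact: measurable_coord.
    by apply/seteqP; split => x xO i; [move=> _; exact: xO|exact: (xO i I)].
  - move=> x [/= xs xO] i; rewrite in_itv/= ltW//= (le_trans _ xs)//.
    rewrite /norm1 (bigD1 i)//= lerDl sumr_ge0// => j _; exact: ltW.
rewrite (lebesgue_rV_box (B := fun=> `[0, s]%classic))//.
rewrite (eq_bigr (fun=> s%:E)).
  by rewrite prodEFin ltry.
move=> i _; rewrite lebesgue_measure_itv/= lte_fin oppr0 adde0.
by case: ltP => // s0'; congr EFin; apply/eqP; rewrite eq_le s0 s0'.
Qed.

Lemma norm1_le_cvg0 (s : nat -> R) : s @ \oo --> 0 -> nonincreasing_seq s ->
  P0 (C @^-1` norm1_ball (s j)) @[j --> \oo] --> 0%E.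
Proof.
move=> s0 sni.
have mF j : measurable (C @^-1` norm1_ball (s j)).
  by rewrite -[X in measurable X]setTI;
    exact: (@measurable_funPT _ _ _ _ C _ _ (measurable_norm1_ball (s j))).
have := @nonincreasing_cvg_mu _ _ _ P0 (fun j => C @^-1` norm1_ball (s j)).
rewrite (_ : \bigcap_j _ = set0) ?measure0; last first.
  apply/seteqP; split => // w ws; have := norm1_gt0 (C_pos w).
  have : norm1 (C w) <= 0.
    rewrite -(cvg_lim (@Rhausdorff R) s0); apply: limr_ge; first exact: cvgP s0.
    by apply: nearW => j; exact: ws.
  by rewrite leNgt => /negP.
apply => //.
- by rewrite -ge0_fin_numE// fin_num_measure.
- by move=> i j ij; apply/subsetPset => w /= /le_trans; apply; exact: sni.
Qed.

Section density.
Variable rho : 'rV[R]_n -> R.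
Hypothesis C_rho : has_density C rho.

Lemma distribution_scale (k : R) (B : set 'rV[R]_n) : 0 < k -> measurable B ->
  distribution P0 C [set x | B (k^-1 *: x)] =
  ((k ^+ n)%:E * \int[leb]_(x in B `&` orthant R n) (rho (k *: x))%:E)%E.
Proof.
move=> k0 mB; have [rho0 mrho dC] := C_rho.
have mkB : measurable [set x : 'rV[R]_n | B (k^-1 *: x)].
  by rewrite -[X in measurable X]setTI; exact: measurable_scale.
have mO := measurable_orthant.
have mkBO : measurable ([set x : 'rV[R]_n | B (k^-1 *: x)] `&` orthant R n).
  exact: measurableI.
rewrite dC// integral_mkcond (@ge0_integral_scale R n k)//; last 2 first.
- apply/(measurable_restrictT _ mkBO); apply/measurable_EFinP.
  by apply: measurable_funS mrho => // x [].
- move=> x; rewrite erestrict_ge0// => y [_ yO]; rewrite lee_fin; exact: rho0.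
rewrite [in RHS]integral_mkcond; congr (_ * _)%E; apply: eq_integral => x _.
rewrite /patch; congr (if _ then _ else _).
apply/idP/idP; rewrite !inE => -[/=]; rewrite scalerA mulVf ?gt_eqF// scale1r.
  by move=> Bx /(orthantZ _ k0).
by move=> Bx xO; split => //; exact/(orthantZ _ k0).
Qed.

Lemma measurable_rho_scale (k : R) : 0 < k ->
  measurable_fun (orthant R n) (fun x => rho (k *: x)).
Proof.
move=> k0; have [_ mrho _] := C_rho.
apply: (measurable_comp measurable_orthant _ mrho) => //.
  by move=> _ [x xO <-]; exact/orthantZ.
by apply: measurable_funS (@measurable_scale R n k).
Qed.


Variables (alpha : R) (h : 'rV[R]_n -> R).
Hypothesis h_ge0 : forall x, orthant R n x -> 0 <= h x.
Hypothesis mh : measurable_fun (orthant R n) h.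
Hypothesis h_int : (0 < \int[leb]_(x in orthant R n) (h x)%:E)%E.
Let resc (k : R) (x : 'rV[R]_n) := k `^ (- alpha) * rho (k *: x).
Hypothesis resc_h : forall x, orthant R n x -> resc k x @[k --> 0^'+] --> h x.
Hypothesis resc_unif : {uniform simplex R n, resc k @[k --> 0^'+] --> h}.
Let gamma : R := n%:R + alpha.

Lemma distribution_scale_ball (k r : R) : 0 < k ->
  (\int[leb]_(x in norm1_ball r `&` orthant R n) (resc k x)%:E =
   (k `^ (- gamma))%:E * P0 (C @^-1` norm1_ball (k * r)))%E.
Proof.
move=> k0; have mB := measurable_norm1_ball r.
have mBO : measurable (norm1_ball r `&` orthant R n).
  by apply: measurableI => //; exact: measurable_orthant.
have [rho0 _ _] := C_rho.
have := distribution_scale k0 mB.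
rewrite (_ : [set x | norm1_ball r (k^-1 *: x)] = norm1_ball (k * r)); last first.
  by apply/seteqP; split => x; rewrite /norm1_ball/= norm1Z
    ler_pdivrMl.
rewrite /distribution/= /pushforward => ->.
rewrite muleA -EFinM -ge0_integralZl_EFin//; last 3 first.
- by move=> x [_ xO]; rewrite lee_fin rho0//; exact/orthantZ.
- apply/measurable_EFinP; apply: measurable_funS (measurable_rho_scale k0).
    exact: measurable_orthant.
  by move=> x [].
- by rewrite mulr_ge0// ?powR_ge0// exprn_ge0// ltW.
apply: eq_integral => x _; rewrite -EFinM; congr (EFin (_ * _)).
have kn0 : k ^+ n != 0 by rewrite expf_neq0// gt_eqF.
rewrite /gamma opprD powRD; last by apply/implyP => _; rewrite gt_eqF.
by rewrite [k `^ (- n%:R)]powRN powR_mulrn ?ltW// mulrAC mulVf// mul1r.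
Qed.

Lemma natSinv_cvg0 : (fun j : nat => j.+1%:R^-1 : R) @ \oo --> 0.
Proof. exact: cvg_harmonic. Qed.

(** Otherwise, [gamma] being nonpositive, the integral over a ball of the
    rescaled density is at most the probability that [C] lies in a ball shrinking
    to the origin, which tends to 0.  By Fatou's lemma, [h] would have integral 0
    over every ball. *)
Lemma exponent_gt0 : 0 < gamma.
Proof.
rewrite ltNge; apply/negP => gamma0.
have mO := measurable_orthant.
have [rho0 _ _] := C_rho.
have mBO r : measurable (norm1_ball r `&` orthant R n).
  by apply: measurableI => //; exact: measurable_norm1_ball.
have int0 r : 0 <= r ->
    (\int[leb]_(x in norm1_ball r `&` orthant R n) (h x)%:E = 0)%E.
  move=> r0; apply/eqP; rewrite eq_le; apply/andP; split; last first.
    by apply: integral_ge0 => x [_ xO]; rewrite lee_fin h_ge0.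
  pose k (j : nat) : R := j.+1%:R^-1.
  have k0 j : 0 < k j by rewrite invr_gt0.
  have := @fatou _ _ R leb _ (mBO r) (fun j x => (resc (k j) x)%:E).
  have -> : (\int[leb]_(x in norm1_ball r `&` orthant R n)
      limn_einf (fun j => (resc (k j) x)%:E) =
      \int[leb]_(x in norm1_ball r `&` orthant R n) (h x)%:E)%E.
    apply: eq_integral => x; rewrite inE => -[_ xO].
    have cx : (resc (k j) x)%:E @[j --> \oo] --> (h x)%:E.
      apply: cvg_EFin; first exact: nearW.
      have [+ _] := cvg_at_rightP (fun k => resc k x) 0 (h x).
      move=> /(_ (resc_h xO) k); apply.
      by split; [move=> j; exact: k0|exact: natSinv_cvg0].
    by have [-> _] := cvg_limn_einf_sup cx.
  have -> : (limn_einf (fun j =>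
      \int[leb]_(x in norm1_ball r `&` orthant R n) (resc (k j) x)%:E) = 0)%E.
    suff c0 : (\int[leb]_(x in norm1_ball r `&` orthant R n) (resc (k j) x)%:E)%E
        @[j --> \oo] --> 0%E by have [-> _] := cvg_limn_einf_sup c0.
    apply: (@squeeze_cvge _ _ _ _ (cst 0%E) _ (fun j => P0 (C @^-1` norm1_ball (k j * r)))).
    - apply: nearW => j; apply/andP; split.
        by apply: integral_ge0 => x [_ xO];
          rewrite lee_fin mulr_ge0 ?powR_ge0// rho0//; exact/orthantZ.
      rewrite distribution_scale_ball// -[leRHS]mul1e lee_wpmul2r// lee_fin.
      rewrite -[leRHS](powRr0 (k j)); apply: ger_powR; last by rewrite oppr_ge0.
      by rewrite k0/= invf_le1// ler1n.
    - exact: cvg_cst.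
    - apply: norm1_le_cvg0.
        by rewrite -(mul0r r); exact: (cvgM natSinv_cvg0 (cvg_cst r)).
      move=> i j ij; rewrite ler_wpM2r// /k lef_pV2 ?posrE// ler_nat.
      exact: leq_ltn_trans ij _.
  apply.
  - move=> j; apply/measurable_EFinP; apply: measurable_funM => //.
    by apply: measurable_funS (measurable_rho_scale (k0 j)) => // x [].
  - move=> j x [_ xO]; rewrite lee_fin mulr_ge0 ?powR_ge0// rho0//; exact/orthantZ.
have := @ge0_nondecreasing_set_cvg_integral _ _ R
  (fun m : nat => norm1_ball m%:R `&` orthant R n) (fun x => (h x)%:E) leb.
rewrite -setI_bigcupl (_ : \bigcup_i _ = setT) ?setTI; last first.
  apply/seteqP; split => // x _.
  have [m _ /(_ m (leqnn m)) xm] := nbhs_infty_gtr (norm1 x).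
  by exists m => //; exact: ltW.
rewrite (_ : (fun i : nat => _) = cst 0%E); last first.
  by apply/funext => m; exact: int0.
move=> H;
  have {}H : (cst 0%E : nat -> \bar R) @ \oo --> (\int[leb]_(x in orthant R n) (h x)%:E)%E.
  apply: H.
  - move=> i j ij; apply/subsetPset => x [xi xO]; split => //.
    by rewrite /norm1_ball/= (le_trans xi)// ler_nat.
  - by move=> i; exact: mBO.
  - by move=> i; apply/measurable_EFinP; apply: measurable_funS mh => // x [].
  - by move=> i x [_ xO]; rewrite lee_fin h_ge0.
have := cvg_unique _ H (cvg_cst _); move=> H'.
by move: h_int; rewrite H' ?ltxx.
Qed.


(** Uniformity on the simplex lets one compare the density at two points of
    the same ray: both rescaled values are within 1 of the same value of [h]. *)
Lemma rho_scale_le : exists2 k0, 0 < k0 & forall t x, 0 < t <= 1 ->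
  orthant R n x -> norm1 x <= k0 ->
  rho (t *: x) <= t `^ alpha * (rho x + 2 * norm1 x `^ alpha).
Proof.
have /resc_unif : nbhs (h : {uniform` simplex R n -> R})
    [set g | forall y, simplex R n y -> `|h y - g y| < 1].
  apply/uniform_nbhs; exists [set xy : R * R | `|xy.1 - xy.2| < 1]; split => //.
  exact: entourage_ball (PosNum ltr01).
move=> [e /= e0 eh].
exists (e / 2); first by rewrite divr_gt0.
move=> t x /andP[t0 t1] xO xe; have x0 := norm1_gt0 xO.
have unif k : 0 < k <= e / 2 ->
    `|h ((norm1 x)^-1 *: x) - resc k ((norm1 x)^-1 *: x)| < 1.
  move=> /andP[k0 ke]; apply: eh => //; last exact: simplex_normalize.
  rewrite /ball/= sub0r normrN gtr0_norm// (le_lt_trans ke)//.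
  by rewrite ltr_pdivrMr// mulr_natr mulr2n ltrDl.
have /unif : 0 < norm1 x <= e / 2 by rewrite x0.
have /unif : 0 < t * norm1 x <= e / 2.
  by rewrite mulr_gt0//= (le_trans _ xe)// ler_piMl// ltW.
rewrite /resc !scalerA -mulrA !mulfV ?gt_eqF// mulr1 scale1r.
rewrite powRM ?(ltW t0) ?(ltW x0)// !powRN.
set a := t `^ alpha; set b := norm1 x `^ alpha.
have a0 : 0 < a by exact: powR_gt0.
have b0 : 0 < b by exact: powR_gt0.
rewrite !ltr_distl => /andP[H1 _] /andP[_ H2].
have : a^-1 * b^-1 * rho (t *: x) <= b^-1 * rho x + 2 by move: H1 H2; lra.
rewrite -(ler_pM2l (mulr_gt0 a0 b0)) => H.
rewrite (_ : rho (t *: x) = a * b * (a^-1 * b^-1 * rho (t *: x))); last first.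
  by field; rewrite !gt_eqF.
rewrite (le_trans H)// le_eqVlt; apply/orP; left; apply/eqP.
by field; rewrite gt_eqF.
Qed.

Definition norm1_shell (s : R) := norm1_ball s `\` norm1_ball (s / 2).

(** Shrinking a shell by [t] multiplies its volume by [t^n] and the density, up
    to a bounded term, by [t^alpha]; the integral of the density over the
    outermost shell is a probability, hence finite. *)
Lemma shell_le : exists k0 c, [/\ 0 < k0, 0 <= c & forall t, 0 < t <= 1 ->
  fine (P0 (C @^-1` norm1_shell (t * k0))) <= c * t `^ gamma].
Proof.
have [k0 k00 rho_le] := rho_scale_le.
have [rho0 mrho dC] := C_rho.
pose S := norm1_shell k0 `&` orthant R n.
have mSh : measurable (norm1_shell k0).
  by apply: measurableD; exact: measurable_norm1_ball.
have mS : measurable S by apply: measurableI => //; exact: measurable_orthant.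
(* the power alpha is monotone on the shell, but alpha may have either sign *)
pose m := Num.max ((k0 / 2) `^ alpha) (k0 `^ alpha).
have k20 : 0 < k0 / 2 by rewrite divr_gt0.
have Sm x : S x -> norm1 x `^ alpha <= m.
  move=> [[/= xk /negP]]; rewrite -ltNge => kx xO; rewrite le_max.
  have x0 := norm1_gt0 xO.
  have [a0|a0] := leP 0 alpha.
    by apply/orP; right; rewrite ge0_ler_powR// nnegrE ltW.
  apply/orP; left; rewrite -[alpha]opprK ![_ `^ (- - _)]powRN.
  rewrite lef_pV2 ?posrE ?powR_gt0// ge0_ler_powR ?nnegrE// ?ltW//.
  by rewrite oppr_gt0.
have m0 : 0 <= m by rewrite le_max powR_ge0.
have lebS : (leb S < +oo)%E.
  apply: le_lt_trans (lebesgue_bounded (ltW k00)).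
  apply: le_measure; rewrite ?inE//.
    by apply: measurableI; [exact: measurable_norm1_ball|exact: measurable_orthant].
  by move=> x [[]].
have mrhoS : measurable_fun S (fun x => (rho x)%:E).
  by apply/measurable_EFinP; apply: measurable_funS mrho => //;
    [exact: measurable_orthant|move=> x []].
have intS : (\int[leb]_(x in S) (rho x)%:E = P0 (C @^-1` norm1_shell k0))%E.
  by rewrite -dC.
exists k0, (fine (P0 (C @^-1` norm1_shell k0)) + 2 * m * fine (leb S)).
split => //.
  by rewrite addr_ge0 ?fine_ge0// mulr_ge0 ?fine_ge0// mulr_ge0.
move=> t t01; have /andP[t0 t1] := t01.
have fS : leb S \is a fin_num by rewrite ge0_fin_numE.
have fC A : measurable A -> P0 (C @^-1` A) \is a fin_num.
  by move=> mA; rewrite fin_num_measure// -[X in measurable X]setTI;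
    exact: measurable_funPT.
rewrite -lee_fin fineK; last first.
  by apply: fC; apply: measurableD; exact: measurable_norm1_ball.
have := distribution_scale t0 mSh.
rewrite (_ : [set x | norm1_shell k0 (t^-1 *: x)] = norm1_shell (t * k0)); last first.
  apply/seteqP; split => x; rewrite /norm1_shell /norm1_ball/= norm1Z;
  by rewrite !ler_pdivrMl// mulrA.
rewrite /distribution/= /pushforward => ->.
have tg : t ^+ n * t `^ alpha = t `^ gamma.
  by rewrite /gamma powRD ?powR_mulrn ?ltW//; apply/implyP => _; rewrite gt_eqF.
rewrite mulrC EFinM -tg EFinM -muleA lee_pmul2l ?lte_fin ?exprn_gt0//.
apply: (@le_trans _ _ (\int[leb]_(x in S) ((t `^ alpha)%:E * ((rho x)%:E + (2 * m)%:E)))%E).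
  apply: ge0_le_integral => //.
  - by move=> x [_ xO]; rewrite lee_fin rho0//; exact/orthantZ.
  - apply/measurable_EFinP; apply: measurable_funS (measurable_rho_scale t0).
      exact: measurable_orthant.
    by move=> x [].
  - by apply: measurable_funeM; apply: emeasurable_funD => //; exact: measurable_cst.
  move=> x Sx; have [[xk _] xO] := Sx; rewrite -EFinD -EFinM lee_fin.
  apply: le_trans (rho_le _ _ t01 xO xk) _.
  by rewrite ler_wpM2l ?powR_ge0// lerD2l ler_wpM2l// Sm.
rewrite ge0_integralZl_EFin ?powR_ge0//; last 2 first.
- by move=> x [_ xO]; rewrite adde_ge0// lee_fin ?rho0// mulr_ge0.
- by apply: emeasurable_funD => //; exact: measurable_cst.
rewrite ge0_integralD//; last 2 first.
- by move=> x [_ xO]; rewrite lee_fin rho0.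
- by move=> x _; rewrite lee_fin mulr_ge0.
by rewrite intS integral_cst//= EFinD fineK ?fC// [in leRHS]EFinM fineK.
Qed.

(** Summing the shell bounds along the scales [s / 2^m] is a geometric series.
    It is presented as the monotonicity of [q (s / 2^m) - c (s / 2^m)^gamma] in
    [m], a sequence that tends to 0. *)
Lemma lower_tail_le : exists2 c, 0 <= c & forall s, 0 < s ->
  fine (P0 (C @^-1` norm1_ball s)) <= c * s `^ gamma.
Proof.
have g0 := exponent_gt0.
have [k0 [c1 [k00 c10 shell]]] := shell_le.
pose q s := fine (P0 (C @^-1` norm1_ball s)).
have fq s : P0 (C @^-1` norm1_ball s) \is a fin_num.
  rewrite fin_num_measure// -[X in measurable X]setTI; apply: measurable_funPT => //.
  exact: measurable_norm1_ball.
have p1 : (1 : R) `^ gamma = 1 by rewrite powR1.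
have r1 : (2^-1 : R) `^ gamma < 1.
  rewrite -[ltRHS]p1; by apply: gt0_ltr_powR; rewrite ?nnegrE ?invr_ge0// invf_lt1 ?ltr1n.
(* the loss of c s^gamma when s is halved pays for one shell *)
pose c := c1 * k0^-1 `^ gamma / (1 - 2^-1 `^ gamma).
have c0 : 0 <= c.
  by rewrite divr_ge0 ?mulr_ge0 ?powR_ge0// subr_ge0 ltW.
have q_half s : 0 < s <= k0 -> q s - c * s `^ gamma <= q (s / 2) - c * (s / 2) `^ gamma.
  move=> /andP[s0 sk].
  have H : q s <= q (s / 2) + c1 * (s / k0) `^ gamma.
    have sk01 : 0 < s / k0 <= 1 by rewrite divr_gt0//= ler_pdivrMr// mul1r.
    have := shell _ sk01; rewrite divfK ?gt_eqF// => H.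
    apply: (@le_trans _ _ (q (s / 2) + fine (P0 (C @^-1` norm1_shell s)))); last first.
      by rewrite lerD2l.
    have mb u : measurable (C @^-1` norm1_ball u).
      by rewrite -[X in measurable X]setTI; apply: measurable_funPT => //;
        exact: measurable_norm1_ball.
    have mD : measurable (C @^-1` norm1_shell s) by exact: (measurableD (mb s) (mb (s / 2))).
    rewrite /q -fineD// ?fin_num_measure// fine_le ?fin_numD ?fin_num_measure//.
    rewrite -measureU//; last first.
      by apply/seteqP; split => // w [/= ? []].
    apply: le_measure; rewrite ?inE//; first exact: measurableU.
    by move=> w ws; have [|] := pselect (norm1_ball (s / 2) (C w)); [left|right].
  have sk0 : (s / k0) `^ gamma = s `^ gamma * k0^-1 `^ gamma.
    by rewrite powRM ?(ltW s0)// invr_ge0 ltW.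
  have s2 : (s / 2) `^ gamma = s `^ gamma * 2^-1 `^ gamma.
    by rewrite powRM ?(ltW s0)// invr_ge0.
  rewrite sk0 in H; rewrite s2.
  have cE : c * (1 - 2^-1 `^ gamma) = c1 * k0^-1 `^ gamma.
    by rewrite /c divfK// gt_eqF// subr_gt0.
  have cE' : c * (1 - 2^-1 `^ gamma) * s `^ gamma = c1 * (s `^ gamma * k0^-1 `^ gamma).
    by rewrite cE; ring.
  move: H cE'; lra.
have q_small s : 0 < s <= k0 -> q s <= c * s `^ gamma.
  move=> /andP[s0 sk].
  have it m : q s - c * s `^ gamma <= q (s * 2^-1 ^+ m).
    apply: (@le_trans _ _ (q (s * 2^-1 ^+ m) - c * (s * 2^-1 ^+ m) `^ gamma)); last first.
      by rewrite gerBl mulr_ge0// powR_ge0.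
    elim: m => [|m IHm]; first by rewrite expr0 mulr1.
    apply: le_trans IHm _; rewrite exprSr mulrA; apply: q_half.
    rewrite mulr_gt0 ?exprn_gt0 ?invr_gt0//= (le_trans _ sk)//.
    by rewrite ler_piMr ?(ltW s0)// exprn_ile1// ?invr_ge0// invf_le1 ?ler1n.
  rewrite -subr_le0.
  have qm : q (s * 2^-1 ^+ m) @[m --> \oo] --> 0.
    have H : (P0 (C @^-1` norm1_ball (s * 2^-1 ^+ m))) @[m --> \oo] --> 0%E.
      apply: norm1_le_cvg0.
        rewrite -(mulr0 s); apply: (cvgM (cvg_cst s)); apply: cvg_expr.
        by rewrite ger0_norm ?invr_ge0// invf_lt1 ?ltr1n.
      move=> i j ij; rewrite ler_pM2l//; apply: ler_wiXn2l => //.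
      by rewrite invf_le1 ?ler1n.
    exact: fine_cvg H.
  rewrite -(cvg_lim (@Rhausdorff R) qm); apply: limr_ge; first exact: cvgP qm.
  by apply: nearW => m; exact: it.
exists (Num.max c (k0^-1 `^ gamma)); first by rewrite le_max c0.
move=> s s0; have [sk|ks] := leP s k0.
  rewrite (le_trans (q_small s _)) ?s0//.
  by rewrite ler_wpM2r ?powR_ge0// le_max lexx.
apply: (@le_trans _ _ 1).
  by rewrite -lee_fin fineK// probability_le1// -[X in measurable X]setTI;
    apply: measurable_funPT => //; exact: measurable_norm1_ball.
apply: (@le_trans _ _ (k0^-1 `^ gamma * s `^ gamma)); last first.
  by rewrite ler_wpM2r ?powR_ge0// le_max lexx orbT.
rewrite -powRM ?invr_ge0 ?(ltW k00) ?(ltW s0)//.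
rewrite -[leLHS]p1 ge0_ler_powR ?nnegrE ?(ltW g0)//.
  by rewrite mulr_ge0 ?invr_ge0 ?(ltW k00) ?(ltW s0).
by rewrite ler_pdivlMl// mulr1 ltW.
Qed.

End density.
End lower_tail.

(** * Laplace transforms *)

Section laplace.
Context {R : realType} d (T : measurableType d) (P : probability T R).
Variables (X : T -> R) (g c : R).
Hypothesis mX : measurable_fun setT X.
Hypothesis X0 : forall w, 0 <= X w.
Hypothesis g0 : 0 < g.
Hypothesis tail : forall s, 0 < s -> fine (P [set w | X w <= s]) <= c * s `^ g.

Let L (t : R) := \int[P]_w expR (- (t * X w)).

Lemma measurable_laplace (t : R) :
  measurable_fun setT (fun w => expR (- (t * X w))).
Proof.
apply: measurableT_comp => //; apply: measurableT_comp => //.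
exact: measurable_funM.
Qed.

Lemma laplace_le1 t w : 0 <= t -> `|expR (- (t * X w))| <= 1.
Proof.
by move=> t0; rewrite ger0_norm ?expR_ge0// expR_le1 oppr_le0 mulr_ge0.
Qed.

(** Where [X > A / t], half of the exponent already contributes the factor
    [exp (- A / 2)]. *)
Lemma laplace_halve (t A : R) : 0 < t -> 0 < A ->
  L t <= expR (- (A / 2)) * L (t / 2) + 2 * (c * (A / t) `^ g).
Proof.
move=> t0 A0.
have mB : measurable [set w | X w <= A / t].
  rewrite (_ : [set w | _] = setT `&` (X @^-1` `]-oo, A / t]%classic)).
    exact: mX.
  by rewrite setTI; apply/seteqP; split => w /=; rewrite in_itv.
have t20 : 0 <= t / 2 by rewrite divr_ge0 ?ltW.
have e1 : expR (- (A / 2)) <= 1 by rewrite expR_le1 oppr_le0 divr_ge0 ?ltW.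
have m2 := measurable_laplace (t / 2).
have := @le_Rintegral_off R _ T P 1 0 (fun w => expR (- (t * X w)))
  (fun w => expR (- (A / 2)) * expR (- (t / 2 * X w))) _ mB.
rewrite RintegralZl//; last first.
  by apply: (@bounded_integrable _ _ _ P _ 1) => // w; exact: laplace_le1.
move=> H; apply: le_trans (H _ _ _ _ _ _) _ => //.
- exact: measurable_laplace.
- exact: measurable_funM.
- by move=> w; exact/laplace_le1/ltW.
- move=> w; rewrite normrM -[leRHS]mul1r ler_pM//; last exact: laplace_le1.
  by rewrite ger0_norm ?expR_ge0.
- move=> w /negP; rewrite -ltNge ltr_pdivrMr// => Aw.
  rewrite addr0 -expRD ler_expR.
  by rewrite [X in _ - X](_ : _ = t * X w / 2); [lra|field].
by rewrite lerD2l add0r mulr1 ler_wpM2l// tail// divr_gt0.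
Qed.

(** Induction on the number of halvings that bring [t] below 1. *)
Lemma laplace_le : exists2 D, 0 <= D & forall t, 0 < t -> L t <= D * t `^ (- g).
Proof.
(* this A makes exp (- A / 2) 2^g equal to 1 / 2, which absorbs the induction
   hypothesis into half of D *)
pose A := 2 * ln (2 * 2 `^ g).
have p2 : 0 < 2 `^ g :> R by exact: powR_gt0.
have p21 : 1 <= 2 `^ g :> R.
  by rewrite -[leLHS](powRr0 (2 : R)) ler_powR ?ler1n// ltW.
have A0 : 0 < A by rewrite mulr_gt0// ln_gt0//; move: p21; lra.
have eA : expR (- (A / 2)) = (2 * 2 `^ g)^-1.
  by rewrite /A mulrC mulKf// expRN lnK// posrE mulr_gt0.
pose D := Num.max 1 (4 * (c * A `^ g)).
have D1 : 1 <= D by rewrite le_max lexx.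
have D0 : 0 <= D by rewrite (le_trans _ D1).
have DA : 4 * (c * A `^ g) <= D by rewrite le_max lexx orbT.
exists D => // t.
have [m tm] : exists m : nat, t <= 2 ^+ m.
  have [m _ /(_ m (leqnn m)) tm] := nbhs_infty_gtr t.
  exists m; rewrite (le_trans (ltW tm))// -natrX ler_nat ltnW// ltn_expl//.
elim: m t tm => [|m IH] t tm t0.
  apply: (@le_trans _ _ 1).
    have -> : 1 = \int[P]_w (fun=> 1) w :> R.
      by rewrite Rintegral_cst// [X in fine X]probability_setT mulr1.
    apply: le_Rintegral => //.
    - apply: (@bounded_integrable _ _ _ P _ 1); first exact: measurable_laplace.
      by move=> w; exact/laplace_le1/ltW.
    - by apply: (@bounded_integrable _ _ _ P _ 1) => // w; rewrite normr1.
    - by move=> w _; rewrite (le_trans (ler_norm _))// laplace_le1// ltW.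
  rewrite (le_trans D1)// ler_peMr// powRN invf_ge1 ?powR_gt0//.
  rewrite expr0 in tm; by rewrite -[leRHS](powRr0 t) ger_powR ?t0// ltW.
have t2 : t / 2 <= 2 ^+ m by rewrite ler_pdivrMr// mulrC -exprS.
have := IH _ t2; rewrite divr_gt0// => /(_ isT) {}IH.
apply: (le_trans (laplace_halve t0 A0)); rewrite eA.
have tg : 0 < t `^ (- g) by exact: powR_gt0.
have At : (A / t) `^ g = A `^ g * t `^ (- g).
  rewrite powRM ?(ltW A0) ?invr_ge0 ?(ltW t0)//; congr (_ * _).
  by rewrite -[t^-1]powR_inv1 ?(ltW t0)// -powRrM mulN1r.
have t2g : (t / 2) `^ (- g) = t `^ (- g) * 2 `^ g.
  rewrite powRM ?(ltW t0) ?invr_ge0//; congr (_ * _).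
  by rewrite -powR_inv1// -powRrM mulN1r opprK.
rewrite At;
  apply: (@le_trans _ _ ((2 * 2 `^ g)^-1 * (D * (t `^ (- g) * 2 `^ g)) + D / 2 * t `^ (- g))).
  rewrite lerD//.
    by rewrite ler_wpM2l ?invr_ge0 ?mulr_ge0 ?(ltW p2)// -t2g.
  by rewrite !mulrA ler_wpM2r ?(ltW tg)//; move: DA; rewrite !mulrA; lra.
by rewrite le_eqVlt; apply/orP; left; apply/eqP; field; rewrite gt_eqF.
Qed.

End laplace.

(** * Tightness and Markov's inequality *)

Lemma near_cvge_lt {R : realType} (u : nat -> \bar R) (l b : \bar R) :
  u @ \oo --> l -> (l < b)%E -> \forall j \near \oo, (u j < b)%E.
Proof. by move=> ul lb; exact: (ul _ (open_ereal_lt' lb)). Qed.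

Section tightness.
Context {R : realType} {n : nat}.
Hypothesis n2 : (2 <= n)%N.
Local Notation E := (simplex_fun R n).

Lemma eval_continuous (delta : R) (p : csimplex R n) : 0 < delta ->
  core delta p -> continuous (fun f : E => f p).
Proof.
move=> d0 dp f; apply/(@cvgrPdist_le _ _ E (nbhs f) _) => e e0.
by have := nbhs_uclose n2 f d0 e0; apply: filterS => g /= fg; exact: fg.
Qed.

Lemma shift_continuous (c : R) :
  continuous ((fun f => (fun p => f p + c) : E) : E -> E).
Proof.
move=> f U /= /uclose_nbhs[delta [s [d0 s0 fU]]].
have := nbhs_uclose n2 f d0 s0; apply: filterS => g fg; apply: fU => p dp.
by rewrite opprD addrACA subrr addr0; exact: fg.
Qed.

Lemma shift_Ctilde (c : R) (f : E) : Ctilde f -> Ctilde ((fun p => f p + c) : E).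
Proof.
move=> [cf vf]; split.
  move=> p; apply: (@continuousD _ _ _ (f : csimplex R n -> R) (fun=> c)).
    exact: cf.
  exact: cst_continuous.
move=> t p q r t01 /(vf t p q r t01); lra.
Qed.

Context d (T : measurableType d) (P : probability T R).
Context d' (T' : measurableType d') (Q : probability T' R).
Variables (S : set E) (Z : nat -> T -> E) (W : T' -> E).
Hypothesis ZW : cvg_in_law P Q S Z W.

(** The tail of [Z K w p] is dominated by the mean of a continuous truncation,
    which converges to its mean under the limit law; there it can be made small
    by shifting the truncation. *)
Lemma eval_tight (delta e : R) (p : csimplex R n) : 0 < delta -> core delta p ->
  0 < e -> exists2 M : R, 0 <= M & \forall K \near \oo,
    measurable [set w | M < Z K w p] /\ (P [set w | (M < Z K w p)%R] <= e%:E)%E.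
Proof.
move=> d0 dp e0; have [SZ SW cvgZ] := ZW.
pose F (j : nat) (f : E) : R := Num.min 1 (Num.max 0 (f p - j%:R)).
have cF j : continuous (F j).
  have cc (r : R) : continuous (fun _ : E => r) by exact: cst_continuous.
  have ce : continuous (fun f : E => f p - j%:R).
    move=> f; apply: (@continuousB _ _ _ (fun f : E => f p) (fun=> j%:R)).
      exact: eval_continuous dp f.
    exact: cc.
  move=> f; apply: (@continuous_min _ E (fun=> 1) (fun f => Num.max 0 (f p - j%:R))).
    exact: cc.
  apply: (@continuous_max _ E (fun=> 0) (fun f => f p - j%:R)); first exact: cc.
  exact: ce.
have cFS j : {within S, continuous (F j)} by exact: continuous_subspaceT (cF j).
have F0 j f : 0 <= F j f by rewrite le_min ler01/= le_max lexx.
have F1 j f : `|F j f| <= 1 by rewrite ger0_norm// ge_min lexx.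
have mFW j := random_element_measurable SW (cFS j).
have mFZ j K := random_element_measurable (SZ K) (cFS j).
have FW0 : (\int[Q]_w (F j (W w))%:E)%E @[j --> \oo] --> 0%E.
  have := @dominated_convergence _ T' R Q setT measurableT
    (fun j w => (F j (W w))%:E) (fun w => 0%E) (fun=> 1%E).
  case.
  - by move=> j; apply/measurable_EFinP; exact: mFW.
  - exact: measurable_cst.
  - apply: aeW => w _; apply: cvg_EFin; first exact: nearW.
    apply: (@cvg_near_cst _ _ (0 : R) (fun j => F j (W w))).
    near=> j => /=; rewrite /F (elimT max_idPl) ?(elimT min_idPr)//.
    by rewrite subr_le0; near: j; exact: nbhs_infty_ger.
  - by apply: (@bounded_integrable _ _ _ Q (fun=> 1) 1) => // w; rewrite normr1.
  - by apply: aeW => w j _; rewrite lee_fin; exact: F1.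
  by move=> _ _; rewrite integral0.
have [j Fj] : exists j, (\int[Q]_w (F j (W w))%:E < e%:E)%E.
  near \oo => j; exists j; near: j.
  by apply: near_cvge_lt FW0 _; rewrite lte_fin.
have cZ : ('E_P[F j \o Z K] @[K --> \oo] --> 'E_Q[F j \o W])%E.
  by apply: cvgZ => //; exists 1 => f _; exact: F1.
exists j.+1%:R => //; near=> K.
have mev : measurable_fun setT ((fun f : E => f p) \o Z K).
  apply: random_element_measurable (SZ K) _; apply: continuous_subspaceT.
  exact: eval_continuous dp.
have mB : measurable [set w | j.+1%:R < Z K w p].
  rewrite (_ : [set w | _] = setT `&` (((fun f : E => f p) \o Z K) @^-1` `]j.+1%:R, +oo[%classic)).
    exact: mev.
  by rewrite setTI; apply/seteqP; split => w /=; rewrite in_itv/= andbT.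
split => //; apply: (@le_trans _ _ 'E_P[F j \o Z K]%E).
  rewrite -(expectation_indic P mB); apply: expectation_le => //.
  - by move=> w /=; exact: F0.
  - apply: aeW => w; rewrite indicE; have [Bw|nBw] := pselect (j.+1%:R < Z K w p).
      rewrite mem_set//= /F le_min lexx/= le_max; apply/orP; right.
      by rewrite lerBrDr -natr1 in Bw *; rewrite addrC ltW.
    by rewrite memNset//= F0.
by apply: ltW; near: K; apply: near_cvge_lt cZ _; rewrite unlock; exact: Fj.
Unshelve. all: end_near. Qed.

End tightness.

Lemma markov_le {R : realType} d (T : measurableType d) (P : probability T R)
    (Y : T -> R) (L m : R) : measurable_fun setT Y -> (forall w, 0 <= Y w) ->
  0 < L -> (\int[P]_w (Y w)%:E <= m%:E)%E ->
  measurable [set w | L < Y w] /\ (P [set w | (L < Y w)%R] <= (m / L)%:E)%E.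
Proof.
move=> mY Y0 L0 Ym.
have mB : measurable [set w | L < Y w].
  rewrite (_ : [set w | _] = setT `&` (Y @^-1` `]L, +oo[%classic)); first exact: mY.
  by rewrite setTI; apply/seteqP; split => w /=; rewrite in_itv/= andbT.
split=> //; rewrite mulrC EFinM -lee_pdivrMl ?invr_gt0// invrK; apply: le_trans Ym.
have mYE : measurable_fun setT (fun w => (Y w)%:E) by exact/measurable_EFinP.
apply: (@le_trans _ _ (\int[P]_(w in [set w | (L < Y w)%R]) (Y w)%:E)%E).
  rewrite -integral_cst//; apply: ge0_le_integral => //.
  - by move=> w _; rewrite /cst lee_fin ltW.
  - exact: measurable_funTS.
  - by move=> w /= /ltW; rewrite lee_fin.
by apply: ge0_subset_integral => // w _; rewrite lee_fin.
Qed.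

(** * Soft minima up to a deterministic shift *)

Section tail_of_homogeneous.
Context {R : realType} {n : nat}.
Hypothesis n2 : (2 <= n)%N.
Context d0 (T0 : measurableType d0) (P0 : probability T0 R).
Variables (C : {RV P0 >-> 'rV[R]_n}) (alpha : R) (h : 'rV[R]_n -> R).
Hypothesis C_pos : forall w, orthant R n (C w).
Hypothesis C_hom : asymp_homogeneous C alpha h.

Lemma homogeneity_exponent_gt0 : 0 < n%:R + alpha.
Proof.
have [rho [C_rho h0 mh hint [hl _]]] := C_hom.
exact: (exponent_gt0 n2 C_pos C_rho h0 mh hint hl).
Qed.

Lemma norm1_laplace_le : exists2 D, 0 <= D & forall t, 0 < t ->
  (\int[P0]_w (expR (- (t * norm1 (C w))))%:E <= (D * t `^ (- (n%:R + alpha)))%:E)%E.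
Proof.
have [rho [C_rho h0 mh hint [hl hu]]] := C_hom.
have [c c0 tail] := lower_tail_le n2 C_pos C_rho h0 mh hint hl hu.
have mX : measurable_fun setT (fun w => norm1 (C w)).
  by apply: measurableT_comp; [exact: measurable_norm1|exact: measurable_funPT].
have X0 w : 0 <= norm1 (C w) by exact: norm1_ge0.
have [D D0 HD] := laplace_le mX X0 homogeneity_exponent_gt0 tail.
exists D => // t t0;
  rewrite -[X in (X <= _)%E](_ : 'E_P0[fun w => expR (- (t * norm1 (C w)))]%E = _).
  rewrite (@expectation_Rintegral _ _ _ _ _ 1).
  - by rewrite lee_fin; exact: HD.
  - exact: measurable_laplace.
  - by move=> w; exact: (laplace_le1 X0 w (ltW t0)).
by rewrite unlock.
Qed.

End tail_of_homogeneous.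

Section converging_together_softmin.
Context {R : realType} {n : nat}.
Hypothesis n2 : (2 <= n)%N.
Context d0 (T0 : measurableType d0) (P0 : probability T0 R).
Variables (C : {RV P0 >-> 'rV[R]_n}) (alpha : R) (h : 'rV[R]_n -> R).
Hypothesis C_pos : forall w, orthant R n (C w).
Hypothesis C_hom : asymp_homogeneous C alpha h.
Context d (T : measurableType d) (P : probability T R).
Variable X : nat -> {RV P >-> 'rV[R]_n}.
Hypothesis X_pos : forall k w, orthant R n (X k w).
Hypothesis X_C : forall k (A : set 'rV[R]_n), measurable A ->
  distribution P (X k) A = distribution P0 C A.

Local Notation gamma := (n%:R + alpha).
Let a (K : nat) : R := K%:R `^ gamma^-1.

Lemma scale_gt0 K : (0 < K)%N -> 0 < a K.
Proof. by move=> K0; rewrite powR_gt0// ltr0n. Qed.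

Lemma mean_copy (f : 'rV[R]_n -> R) k : measurable_fun setT f ->
  (forall x, 0 <= f x) ->
  (\int[P]_w (f (X k w))%:E = \int[P0]_w (f (C w))%:E)%E.
Proof.
move=> mf f0.
have mfE : measurable_fun setT (EFin \o f) by exact/measurable_EFinP.
rewrite -(@ge0_integral_distribution _ _ _ _ _ P (X k) (EFin \o f))//.
rewrite -(@ge0_integral_distribution _ _ _ _ _ P0 C (EFin \o f))//.
by apply: eq_measure_integral => A mA _; exact: X_C.
Qed.

Definition laplace_sum (delta : R) K (w : T) : R :=
  \sum_(k < K) expR (- (delta * a K * norm1 (X k w))).

Lemma measurable_expR_norm1 (t : R) :
  measurable_fun setT (fun x : 'rV[R]_n => expR (- (t * norm1 x))).
Proof.
apply: measurableT_comp => //; apply: measurableT_comp => //.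
by apply: measurable_funM => //; exact: measurable_norm1.
Qed.

Lemma measurable_laplace_sum delta K : measurable_fun setT (laplace_sum delta K).
Proof.
apply: measurable_sum => k.
apply: (measurableT_comp (measurable_expR_norm1 (delta * a K))).
exact: measurable_funPT.
Qed.

(** The scale [a K] satisfies [K (a K)^(- gamma) = 1]. *)
Lemma laplace_sum_mean : exists2 D, 0 <= D & forall delta K, 0 < delta ->
  (0 < K)%N ->
  (\int[P]_w (laplace_sum delta K w)%:E <= (D * delta `^ (- gamma))%:E)%E.
Proof.
have g0 := homogeneity_exponent_gt0 n2 C_pos C_hom.
have [D D0 HD] := norm1_laplace_le n2 C_pos C_hom.
exists D => // delta K delta0 K0; have a0 := scale_gt0 K0.
under eq_integral do rewrite /laplace_sum -sumEFin.
rewrite ge0_integral_sum//; last first.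
  move=> k; apply/measurable_EFinP.
  apply: (measurableT_comp (measurable_expR_norm1 (delta * a K))).
  exact: measurable_funPT.
have aK : K%:R * a K `^ (- gamma) = 1.
  rewrite /a -powRrM mulrN mulVf ?gt_eqF// powR_inv1// mulfV// pnatr_eq0.
  by rewrite -lt0n.
apply: (@le_trans _ _ (\sum_(k < K) (D * (delta * a K) `^ (- gamma))%:E)%E).
  apply: lee_sum => k _.
  rewrite (mean_copy k (f := fun x => expR (- (delta * a K * norm1 x))))//.
    by apply: HD; rewrite mulr_gt0.
  exact: measurable_expR_norm1.
rewrite sumEFin lee_fin sumr_const card_ord -[leLHS]mulr_natl.
rewrite powRM ?(ltW delta0) ?(ltW a0)// mulrCA (mulrCA K%:R) aK mulr1.
by rewrite lexx.
Qed.

Context d' (T' : measurableType d') (Q : probability T' R).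
Variable Psi : T' -> simplex_fun R n.
Local Notation min_fun := (fun K w => (fun p : csimplex R n =>
  K%:R `^ (n%:R + alpha)^-1 * min_lin K (fun k => X k w) (\val p)) : simplex_fun R n).
Hypothesis Psi_lim : cvg_in_law P Q (@Cplus R n) min_fun Psi.
Variable lambda : nat -> R.
Hypothesis lambda_gt0 : forall K, (0 < K)%N -> 0 < lambda K.
Hypothesis lambda_oo : lambda K / a K @[K --> \oo] --> +oo.
Variables (r : nat -> R) (c : R).
Hypothesis r_c : r K + a K * ln K%:R / lambda K @[K --> \oo] --> c.

(** The exceptional set is where the minimum at the barycenter or the Laplace
    sum is large; off it, the error is a constant times [a K / lambda K]. *)
Lemma softmin_close : close_in_probability P
  (fun K w => (fun p => min_fun K w p + c) : simplex_fun R n)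
  (fun K w => softmin_fun (a K) (lambda K) (r K) K (fun k => X k w)).
Proof.
move=> delta s e delta0 s0 e0.
have n0 : (0 < n)%N by exact: ltnW.
have ninv : 0 < n%:R^-1 :> R by rewrite invr_gt0 ltr0n.
have sb : simplex R n (barycenter : 'rV[R]_n).
  apply: simplex_gt0 => //; first by move=> i; rewrite mxE.
  under eq_bigr do rewrite mxE.
  by rewrite sumr_const card_ord -[LHS]mulr_natl mulfV// pnatr_eq0 -lt0n.
have cb : (barycenter : 'rV[R]_n) \in csimplex R n.
  by rewrite inE; exact: subset_closure.
pose b : csimplex R n := SigSub cb.
have bcore : core n%:R^-1 b by move=> i; rewrite mxE.
have e2 : 0 < e / 2 by rewrite divr_gt0.
have [M M0 tight] := eval_tight n2 Psi_lim ninv bcore e2.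
have [D D0 HD] := laplace_sum_mean.
pose m := D * delta `^ (- gamma).
have m0 : 0 <= m by rewrite mulr_ge0// powR_ge0.
(* Markov's inequality at level L leaves a probability of at most e / 2 *)
pose L := m / (e / 2) + 1.
have L0 : 0 < L by rewrite ltr_wpDl// divr_ge0// ltW.
have mL : m / L <= e / 2.
  rewrite ler_pdivrMr// /L mulrDr mulrC divfK ?gt_eqF//; move: e2; lra.
have s2 : 0 < s / 2 by rewrite divr_gt0.
move/cvgrPdist_le : r_c => /(_ _ s2) rc.
near=> K.
have K0 : (0 < K)%N by near: K; exact: nbhs_infty_gt.
have a0 := scale_gt0 K0; have l0 := lambda_gt0 K0.
have [mB1 PB1] : measurable [set w | M < min_fun K w b] /\
    (P [set w | (M < min_fun K w b)%R] <= (e / 2)%:E)%E by near: K.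
have [mB2 PB2] := markov_le (measurable_laplace_sum delta K)
  (fun w => sumr_ge0 _ (fun k _ => expR_ge0 _)) L0 (HD _ _ delta0 K0).
have rK : `|c - (r K + a K * ln K%:R / lambda K)| <= s / 2 by near: K.
have la1 : 1 <= lambda K / a K by near: K; exact: cvgry_ge.
have la2 : (n%:R * M + L) / (s / 2) <= lambda K / a K by near: K; exact: cvgry_ge.
exists ([set w | M < min_fun K w b] `|` [set w | L < laplace_sum delta K w]).
split; first exact: measurableU.
  apply: le_trans (measureU2 _ mB1 mB2) _.
  rewrite [in leRHS](splitr e) EFinD leeD//; apply: le_trans PB2 _.
  by rewrite lee_fin.
move=> w /not_orP[/negP]; rewrite -leNgt => wM /negP; rewrite -leNgt => wL p pd.
have p01 i : 0 <= \val p ord0 i <= 1 by rewrite csimplex_ge0 csimplex_le1.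
have aL : a K <= lambda K by rewrite ler_pdivlMr// mul1r in la1.
have dist := softmin_min_dist (x := fun k => X k w) n0 K0 a0 aL p01 pd
  (fun k => X_pos k w).
have : a K / lambda K * (n%:R * (a K * min_lin K (fun k => X k w) barycenter) +
    laplace_sum delta K w) <= s / 2.
  apply: (@le_trans _ _ (a K / lambda K * (n%:R * M + L))).
    rewrite ler_wpM2l ?divr_ge0 ?(ltW a0) ?(ltW l0)// lerD//.
    by rewrite ler_wpM2l.
  move: la2; rewrite ler_pdivrMr// mulrAC ler_pdivlMr// => la2.
  by rewrite mulrAC ler_pdivrMr// mulrC [leRHS]mulrC.
move=> /(le_trans dist); rewrite /softmin_fun.
move: rK; rewrite -/(a K) !ler_norml => /andP[? ?] /andP[? ?].
by apply/andP; split; lra.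
Unshelve. all: end_near. Qed.

Lemma softmin_cvg_in_law : cvg_in_law P Q (@Ctilde R n)
  (fun K w => softmin_fun (a K) (lambda K) (r K) K (fun k => X k w))
  (fun w => (fun p => Psi w p + c) : simplex_fun R n).
Proof.
have shiftS (f : simplex_fun R n) : Cplus f ->
    Ctilde ((fun p => f p + c) : simplex_fun R n).
  by move=> [cf _]; exact: shift_Ctilde.
have lim := cvg_in_law_map (shift_continuous n2 (c := c)) shiftS Psi_lim.
apply: (cvg_in_law_close n2 lim); last exact: softmin_close.
move=> K; apply: softmin_random_element; first exact: powR_ge0.
- exact: lambda_gt0.
- by move=> k; exact: measurable_funPT.
Qed.

End converging_together_softmin.

Theorem theorem5p1 (R : realType) (n : nat) (n_ge2 : (2 <= n)%N)
  (d0 : measure_display) (T0 : measurableType d0) (P0 : probability T0 R)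
  (C : {RV P0 >-> 'rV[R]_n})
  (C_pos : forall w, orthant R n (C w))
  (alpha : R) (h : 'rV[R]_n -> R)
  (C_hom : asymp_homogeneous C alpha h)
  (d : measure_display) (T : measurableType d) (P : probability T R)
  (X : nat -> {RV P >-> 'rV[R]_n})
  (X_pos : forall k w, orthant R n (X k w))
  (X_iid : iid_copies X C)
  (d' : measure_display) (T' : measurableType d') (Q : probability T' R)
  (Psi : T' -> simplex_fun R n)
  (Psi_lim : cvg_in_law P Q (@Cplus R n)
    (fun K w p => K%:R `^ (n%:R + alpha)^-1 *
                  min_lin K (fun k => X k w) (\val p))
    Psi)
  (lambda : nat -> R)
  (lambda_gt0 : forall K, (0 < K)%N -> 0 < lambda K)
  (lambda_oo : lambda K / K%:R `^ (n%:R + alpha)^-1 @[K --> \oo] --> +oo) :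
  [/\ cvg_in_law P Q (@Ctilde R n)
        (fun K w p =>
           K%:R `^ (n%:R + alpha)^-1 *
             softmin_lin (lambda K) K (fun k => X k w) (\val p)
           - K%:R `^ (n%:R + alpha)^-1 * ln K%:R / lambda K)
        Psi,
      (lambda K / (K%:R `^ (n%:R + alpha)^-1 * ln K%:R) @[K --> \oo] --> +oo) ->
        cvg_in_law P Q (@Ctilde R n)
          (fun K w p => K%:R `^ (n%:R + alpha)^-1 *
             softmin_lin (lambda K) K (fun k => X k w) (\val p))
          Psi &
      forall c : R, 0 < c ->
        (lambda K / (K%:R `^ (n%:R + alpha)^-1 * ln K%:R) @[K --> \oo] --> c) ->
        cvg_in_law P Q (@Ctilde R n)
          (fun K w p => K%:R `^ (n%:R + alpha)^-1 *
             softmin_lin (lambda K) K (fun k => X k w) (\val p))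
          (fun w p => Psi w p + c^-1)].
Proof.
have [_ X_C] := X_iid.
have cvg r c := softmin_cvg_in_law n_ge2 C_pos C_hom X_pos X_C Psi_lim
  lambda_gt0 lambda_oo (r := r) (c := c).
have Psi0 : (fun w => (fun p => Psi w p + 0) : simplex_fun R n) = Psi.
  by apply/funext => w; apply/funext => p; rewrite addr0.
have softmin0 : (fun K w => softmin_fun (K%:R `^ (n%:R + alpha)^-1) (lambda K) 0
    K (fun k => X k w)) = (fun K w => (fun p => K%:R `^ (n%:R + alpha)^-1 *
      softmin_lin (lambda K) K (fun k => X k w) (\val p)) : simplex_fun R n).
  by apply/funext => K; apply/funext => w; apply/funext => p; rewrite /softmin_fun addr0.
have shiftE : (fun K => 0 + K%:R `^ (n%:R + alpha)^-1 * ln K%:R / lambda K) =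
    (fun K => (lambda K / (K%:R `^ (n%:R + alpha)^-1 * ln K%:R))^-1).
  by apply/funext => K; rewrite add0r invf_div.
split.
- rewrite -Psi0; apply: (cvg (fun K =>
    - (K%:R `^ (n%:R + alpha)^-1 * ln K%:R / lambda K))).
  by apply: cvg_near_cst; apply: nearW => K; rewrite addNr.
- move=> lim; rewrite -softmin0 -Psi0; apply: (cvg (fun=> 0)).
  rewrite shiftE; apply/gtr0_cvgV0 => //.
  exact: (cvgry_gt lim 0).
- move=> c c0 lim; rewrite -softmin0; apply: (cvg (fun=> 0)).
  by rewrite shiftE; apply: cvgV lim; rewrite gt_eqF.
Qed.
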